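(* Let $\nu$ be a finite measure on $[0,\infty)$ with moment generating function $g(z)=\int_0^\infty e^{zx}\,\nu(dx)$. Assume that (6.2a) there is a function $g_0(z)=\dfrac{b}{(\alpha-z)^{k}}$, for some positive integer $k$, some complex number $b$ and some real numbers $0<\alpha<\beta$, such that $g(z)-g_0(z)$ is analytic for $\Re z<\beta$; (6.2b) there is $\epsilon_0>0$ such that $g(z)-g_0(z)$ is bounded over all $z\in\mathbb{C}$ with $0\le\Re z\le\beta$ and $|z-\alpha|>\epsilon_0$. Then $$\nu((x,\infty))\sim\frac{b\,\alpha^{-1}}{\Gamma(k)}\,x^{k-1}e^{-\alpha x}\quad\text{as }x\to\infty,$$ that is, $\lim_{x\to\infty}\nu((x,\infty))/(x^{k-1}e^{-\alpha x})=b\,\alpha^{-1}/\Gamma(k)$.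
   Context: $\Gamma(\cdot)$ is the gamma function. The integral defining $g$ is a priori defined for $\Re z\le0$; $g$ also denotes its analytic continuation, so (6.2a) means that $g-g_0$ extends analytically to the half plane $\{\Re z<\beta\}$, and in (6.2b) $g-g_0$ denotes this extension (together with its values at those points of the line $\Re z=\beta$ where it is defined). For functions $f_1,f_2$, $f_1(x)\sim f_2(x)$ means $f_1(x)/f_2(x)\to1$ as $x\to\infty$. *)

(* Defs.v *)
From HB Require Import structures.
From mathcomp Require Import all_boot all_order all_algebra.
From mathcomp Require Import complex.
From mathcomp Require Import all_classical all_reals all_analysis.

Set Implicit Arguments.
Unset Strict Implicit.
Unset Printing Implicit Defensive.

Import Order.TTheory GRing.Theory Num.Theory.
Import numFieldNormedType.Exports.

Local Open Scope classical_set_scope.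
Local Open Scope complex_scope.
Local Open Scope ring_scope.

Definition cexp (R : realType) (z : R[i]) : R[i] :=
  (expR (complex.Re z))%:C * (cos (complex.Im z) +i* sin (complex.Im z)).

(* As for [Rintegral], a meaningful value needs [f] to be integrable. *)
Definition Cintegral d (T : measurableType d) (R : realType)
    (mu : {measure set T -> \bar R}) (D : set T) (f : T -> R[i]) : R[i] :=
  (\int[mu]_(x in D) complex.Re (f x))%R +i*
  (\int[mu]_(x in D) complex.Im (f x))%R.

Definition mgf (R : realType) (nu : {measure set (measurableTypeR R) -> \bar R})
    (z : R[i]) : R[i] :=
  Cintegral nu `[0, +oo[ (fun x : measurableTypeR R => cexp (z * (x : R)%:C)).

(* The scalars are [R[i]], so [derivable f z 1] is the existence of the limit
   of the complex difference quotient; [R[i]^o] is [R[i]] with its structure of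
   normed space over itself. On an open set [A], this is analyticity. *)
Definition analytic_on (R : realType) (A : set R[i]) (f : R[i] -> R[i]) : Prop :=
  forall z, A z -> derivable (f : R[i]^o -> R[i]^o) z 1.

Definition Gamma (R : realType) (s : R) : R :=
  (\int[lebesgue_measure]_(t in `]0%R, +oo[) (t `^ (s - 1) * expR (- t)))%R.

(* Main.v *)
(** Put [j = k - 1]. The function [b / (alpha - z)^k] is the transform of
    [b / j!] times the density [t^j exp(- alpha t)] on the half line, so [h] is
    the transform of the difference of [nu] and a multiple of that density.
    Multiplying by [exp(s^2 z^2 / 2 - x z)] and moving the line of integration
    from [Re z = 0] to [Re z = c], with [alpha < c < beta], shows that after
    convolution with a Gaussian of standard deviation [s] the two measures
    differ by [O(exp(- c x))] at [x], for every fixed [s]. Taking imaginary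
    parts in the same estimate shows that [b] is real. Tails are recovered from
    smoothed tails by letting [s] tend to [0]: a Gaussian of small deviation is
    dominated, away from its centre, by a small multiple of the standard
    Gaussian, so the error is a small multiple of the smoothed tail for
    [s = 1], whose size is known.

    Only the following case of Cauchy's theorem is used: the integral of a
    closed, pointwise differentiable form [P dx + Q dy] around a rectangle
    vanishes. This is Goursat's argument by bisection. *)
Require Import Defs.
From HB Require Import structures.
From mathcomp Require Import all_boot all_order all_algebra.
From mathcomp Require Import complex.
From mathcomp Require Import all_classical all_reals all_analysis.
From mathcomp Require Import measurable_realfun.
From mathcomp Require Import ring lra.

Set Implicit Arguments.
Unset Strict Implicit.
Unset Printing Implicit Defensive.

Import Order.TTheory GRing.Theory Num.Theory.
Import numFieldNormedType.Exports.

Local Open Scope classical_set_scope.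
Local Open Scope complex_scope.
Local Open Scope ring_scope.

(** * Goursat's lemma on rectangles *)

Section Goursat.
Context {R : realType}.
Implicit Types (P Q : R -> R -> R) (a b c d x y : R).
Local Notation mu := (@lebesgue_measure R).

(** On a vertical line the transform is in general only bounded, so the inversion integral need not
    converge, nor the density it should represent exist. The factor [exp(s^2 z^2 / 2)] has modulus
    [exp(s^2 (u^2 - y^2) / 2)] at [z = u + i y]: it makes the integrals absolutely convergent and
    the horizontal sides of the contour negligible. The singular part is subtracted before the
    shift, so no residue is computed. Taking [c < beta] keeps the contour where [h] is analytic, and
    [alpha < c] makes [exp(- c x)] negligible against [x^j exp(- alpha x)].

    The obstacle is that the constant of the smoothed estimate grows like [1 / s]. Hence [s] stays
    fixed while [x] tends to infinity, and tails are compared up to a shift [eta] and a factor close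
    to [1], which are removed only afterwards. The part of a Gaussian beyond distance [eta] has to
    be small relative to a tail that itself decays; domination by the standard Gaussian keeps this
    error relative. *)

Lemma within_continuous_integrable (f : R -> R) a b :
  (forall x, a <= x <= b -> {for x, continuous f}) ->
  mu.-integrable `[a, b] (EFin \o f).
Proof.
move=> cf; apply: continuous_compact_integrable; first exact: segment_compact.
apply: continuous_in_subspaceT => x; rewrite inE/= in_itv/= => xab.
exact: cf.
Qed.

Lemma Rintegral_affine (m n a b : R) : a <= b ->
  \int[mu]_(x in `[a, b]) (m + n * x) = m * (b - a) + n * (b ^+ 2 - a ^+ 2) / 2.
Proof.
rewrite le_eqVlt => /predU1P[->|ab].
  by rewrite set_itv1 Rintegral_set1; ring.
pose F (x : R) := m * x + n / 2 * x ^+ 2.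
have dF (x : R) : is_derive x 1 F (m + n * x).
  by apply: is_derive_eq; rewrite /GRing.scale/=; field.
have := @continuous_FTC2 R (fun x => m + n * x) F a b ab.
rewrite /Rintegral => ->.
- by rewrite -EFinB/= /F; field.
- apply: continuous_subspaceT => x; apply: cvgD; first exact: cvg_cst.
  by apply: cvgM; [exact: cvg_cst|exact: cvg_id].
- have cF : continuous F.
    by move=> x; apply/differentiable_continuous/derivable1_diffP.
  split => [x _||].
  + by [].
  + exact/cvg_at_right_filter/cF.
  + exact/cvg_at_left_filter/cF.
- by move=> x _; rewrite derive1E derive_val.
Qed.

(** With [m] and [n] taken from a linear approximation this controls one side of a small rectangle;
    with [m = n = 0] it is the bound by supremum times length, used for the horizontal sides in
    [contour_shift]. *)
Lemma Rintegral_near_affine (f : R -> R) (m n e a b : R) : a <= b ->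
  (forall x, a <= x <= b -> {for x, continuous f}) ->
  (forall x, a <= x <= b -> `|f x - (m + n * x)| <= e) ->
  `|\int[mu]_(x in `[a, b]) f x - (m * (b - a) + n * (b ^+ 2 - a ^+ 2) / 2)|
    <= e * (b - a).
Proof.
move=> ab cf fe.
have cg x : {for x, continuous (fun x => m + n * x)}.
  apply: cvgD; first exact: cvg_cst.
  by apply: cvgM; [exact: cvg_cst|exact: cvg_id].
have intf := within_continuous_integrable cf.
have intg : mu.-integrable `[a, b] (EFin \o (fun x => m + n * x)).
  exact: within_continuous_integrable.
rewrite -Rintegral_affine// -RintegralB//.
have intfg : mu.-integrable `[a, b] (EFin \o (fun x => f x - (m + n * x))).
  apply: within_continuous_integrable => x xab.
  by apply: cvgB; [exact: cf|exact: cg].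
apply: le_trans (le_normr_Rintegral _ intfg) _ => //.
apply: (@le_trans _ _ (\int[mu]_(x in `[a, b]) e)).
  apply: le_Rintegral => //.
  - apply: within_continuous_integrable => x xab.
    apply: (@cvg_comp _ _ _ _ Num.norm); last exact: norm_continuous.
    by apply: cvgB; [exact: cf|exact: cg].
  - by apply: within_continuous_integrable => x xab; exact: cvg_cst.
rewrite Rintegral_cst//=.
rewrite lebesgue_measure_itv/= lte_fin.
by case: ltP => // ba; rewrite mulr0 (_ : b = a) ?subrr ?mulr0//; apply/eqP; rewrite eq_le ab ba.
Qed.

(* [P dx + Q dy] is differentiable at [(x, y)] and closed there: its partial
   derivatives are [P_x = p], [P_y = Q_x = q] and [Q_y = r]. *)
Definition closed_form_at P Q x y := exists p q r : R,
  forall e : R, 0 < e -> exists2 h : R, 0 < h &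
  forall x' y', `|x' - x| <= h -> `|y' - y| <= h ->
    `|P x' y' - (P x y + p * (x' - x) + q * (y' - y))|
      <= e * (`|x' - x| + `|y' - y|) /\
    `|Q x' y' - (Q x y + q * (x' - x) + r * (y' - y))|
      <= e * (`|x' - x| + `|y' - y|).

Lemma lipschitz_at_continuous (f : R -> R) x (k h : R) : 0 < h ->
  (forall x', `|x' - x| <= h -> `|f x' - f x| <= k * `|x' - x|) ->
  {for x, continuous f}.
Proof.
move=> h0 kf; apply/cvgrPdist_le => /= e e0.
near=> x'.
rewrite distrC; apply: le_trans (kf _ _) _.
  by rewrite distrC; near: x'; apply: cvgr_dist_le => //; exact: cvg_id.
have k1 : 0 < `|k| + 1 by rewrite ltr_pwDr.
apply: (@le_trans _ _ ((`|k| + 1) * `|x' - x|)).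
  by rewrite ler_wpM2r// (le_trans (ler_norm _))// lerDl.
rewrite mulrC -ler_pdivlMr// distrC.
by near: x'; apply: cvgr_dist_le; [exact: cvg_id|exact: divr_gt0].
Unshelve. all: by end_near. Qed.

Lemma closed_form_continuous P Q x y : closed_form_at P Q x y ->
  {for x, continuous (P ^~ y)} /\ {for y, continuous (Q x)}.
Proof.
move=> [p [q [r /(_ 1 ltr01)[h h0 hPQ]]]]; split.
- apply: (@lipschitz_at_continuous _ _ (1 + `|p|) _ h0) => x' x'h.
  have [] := hPQ x' y x'h; first by rewrite subrr normr0 ltW.
  rewrite subrr normr0 mulr0 !addr0 mul1r => le1 _.
  rewrite (_ : P x' y - P x y = (P x' y - (P x y + p * (x' - x))) + p * (x' - x)); last by ring.
  by rewrite (le_trans (ler_normD _ _))// mulrDl mul1r normrM lerD2r.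
- apply: (@lipschitz_at_continuous _ _ (1 + `|r|) _ h0) => y' y'h.
  have [|_] := hPQ x y' _ y'h; first by rewrite subrr normr0 ltW.
  rewrite subrr normr0 mulr0 !addr0 add0r mul1r => le1.
  rewrite (_ : Q x y' - Q x y = (Q x y' - (Q x y + r * (y' - y))) + r * (y' - y)); last by ring.
  by rewrite (le_trans (ler_normD _ _))// mulrDl mul1r normrM lerD2r.
Qed.

Definition boundary_integral P Q a b c d : R :=
  \int[mu]_(x in `[a, b]) P x c + \int[mu]_(y in `[c, d]) Q b y
  - \int[mu]_(x in `[a, b]) P x d - \int[mu]_(y in `[c, d]) Q a y.

Lemma Rintegral_split (f : R -> R) a m b : a <= m <= b ->
  (forall x, a <= x <= b -> {for x, continuous f}) ->
  \int[mu]_(x in `[a, b]) f x =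
  \int[mu]_(x in `[a, m]) f x + \int[mu]_(x in `[m, b]) f x.
Proof.
move=> /andP[am mb] cf; have fint := within_continuous_integrable cf.
have := @Rintegral_itvB _ f (BLeft a) (BRight b) m fint.
rewrite !bnd_simp => /(_ am mb)/eqP; rewrite subr_eq => /eqP ->.
rewrite addrC; congr (_ + _); rewrite Rintegral_itv_obnd_cbnd//.
by apply: integrableS fint => //; apply: subset_itvr; rewrite bnd_simp.
Qed.

Section additivity.
Variables (P Q : R -> R -> R) (a b c d : R).
Hypothesis PQ : forall x y, a <= x <= b -> c <= y <= d -> closed_form_at P Q x y.

(** Only the outer sides are subdivided: each inner side occurs twice with opposite orientations and
    cancels. *)
Lemma boundary_integral_split m n : a <= m <= b -> c <= n <= d ->
  boundary_integral P Q a b c d =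
  boundary_integral P Q a m c n + boundary_integral P Q m b c n +
  (boundary_integral P Q a m n d + boundary_integral P Q m b n d).
Proof.
move=> mab ncd; have [am mb] := andP mab; have [cn nd] := andP ncd.
have ab := le_trans am mb; have cd := le_trans cn nd.
have spP y : c <= y <= d -> \int[mu]_(x in `[a, b]) P x y =
    \int[mu]_(x in `[a, m]) P x y + \int[mu]_(x in `[m, b]) P x y.
  by move=> ycd; apply: Rintegral_split => // x xab; case: (closed_form_continuous (PQ xab ycd)).
have spQ x : a <= x <= b -> \int[mu]_(y in `[c, d]) Q x y =
    \int[mu]_(y in `[c, n]) Q x y + \int[mu]_(y in `[n, d]) Q x y.
  by move=> xab; apply: Rintegral_split => // y ycd; case: (closed_form_continuous (PQ xab ycd)).
rewrite /boundary_integral (spP c) ?lexx// (spP d) ?lexx ?andbT//.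
rewrite (spQ a) ?lexx// (spQ b) ?lexx ?andbT//.
by ring.
Qed.

End additivity.

(** An affine form with the same coefficient [q] for [P_y] and [Q_x] has boundary integral zero, so
    only the errors remain. On each side they are at most [e l] times its length, where [l], half
    the perimeter, bounds the distance to [(x0, y0)]; the sides have total length [2 l]. *)
Lemma boundary_integral_small P Q (x0 y0 p q r e : R) a b c d :
  a <= x0 <= b -> c <= y0 <= d -> 0 <= e ->
  (forall x y, a <= x <= b -> c <= y <= d -> closed_form_at P Q x y) ->
  (forall x y, a <= x <= b -> c <= y <= d ->
    `|P x y - (P x0 y0 + p * (x - x0) + q * (y - y0))|
      <= e * (`|x - x0| + `|y - y0|) /\
    `|Q x y - (Q x0 y0 + q * (x - x0) + r * (y - y0))|
      <= e * (`|x - x0| + `|y - y0|)) ->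
  `|boundary_integral P Q a b c d| <= 2 * e * ((b - a) + (d - c)) ^+ 2.
Proof.
move=> x0ab y0cd e0 cPQ aff.
have [ax0 x0b] := andP x0ab; have [cy0 y0d] := andP y0cd.
have ab := le_trans ax0 x0b; have cd := le_trans cy0 y0d.
pose l := (b - a) + (d - c).
have dist x y : a <= x <= b -> c <= y <= d -> `|x - x0| + `|y - y0| <= l.
  by move=> /andP[? ?] /andP[? ?]; apply: lerD; rewrite ler_norml; lra.
have caa : a <= a <= b by rewrite lexx. have cbb : a <= b <= b by rewrite lexx andbT.
have ccc : c <= c <= d by rewrite lexx. have cdd : c <= d <= d by rewrite lexx andbT.
have EP y : c <= y <= d ->
    `|\int[mu]_(x in `[a, b]) P x y -
      ((P x0 y0 - p * x0 + q * (y - y0)) * (b - a) + p * (b ^+ 2 - a ^+ 2) / 2)|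
    <= e * l * (b - a).
  move=> ycd; apply: Rintegral_near_affine => // x xab.
    by case: (closed_form_continuous (cPQ _ _ xab ycd)).
  have [+ _] := aff x y xab ycd.
  rewrite (_ : _ + _ + _ = P x0 y0 - p * x0 + q * (y - y0) + p * x); last by ring.
  by move=> /le_trans; apply; rewrite ler_wpM2l// dist.
have EQ x : a <= x <= b ->
    `|\int[mu]_(y in `[c, d]) Q x y -
      ((Q x0 y0 - r * y0 + q * (x - x0)) * (d - c) + r * (d ^+ 2 - c ^+ 2) / 2)|
    <= e * l * (d - c).
  move=> xab; apply: Rintegral_near_affine => // y ycd.
    by case: (closed_form_continuous (cPQ _ _ xab ycd)).
  have [_] := aff x y xab ycd.
  rewrite (_ : _ + _ + _ = Q x0 y0 - r * y0 + q * (x - x0) + r * y); last by ring.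
  by move=> /le_trans; apply; rewrite ler_wpM2l// dist.
move: (EP c ccc) (EP d cdd) (EQ a caa) (EQ b cbb).
rewrite /boundary_integral -/l.
move: (\int[mu]_(x in _) P x c) (\int[mu]_(x in _) P x d) => I1 I2.
move: (\int[mu]_(x in _) Q a x) (\int[mu]_(x in _) Q b x) => I3 I4.
rewrite (_ : 2 * e * l ^+ 2 = 2 * (e * l * (b - a)) + 2 * (e * l * (d - c))); last by rewrite /l; ring.
move: (e * l * (b - a)) (e * l * (d - c)) => E1 E2.
rewrite !ler_norml => /andP[? ?] /andP[? ?] /andP[? ?] /andP[? ?].
by apply/andP; split; lra.
Qed.

Lemma exists_half_pow_le (L h : R) : 0 < h -> exists n, L / 2 ^+ n <= h.
Proof.
move=> h0; exists (Num.bound (L / h)).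
rewrite ler_pdivrMr ?exprn_gt0// mulrC -ler_pdivrMr//.
apply: le_trans (_ : (Num.bound (L / h))%:R <= _).
  have [Lh|Lh] := leP 0 (L / h); first by rewrite ltW// archi_boundP.
  by rewrite (le_trans (ltW Lh)).
by rewrite -natrX ler_nat ltnW// ltn_expl.
Qed.

Theorem goursat P Q a b c d : a <= b -> c <= d ->
  (forall x y, a <= x <= b -> c <= y <= d -> closed_form_at P Q x y) ->
  boundary_integral P Q a b c d = 0.
Proof.
move=> ab cd PQ; apply: contrapT => /eqP; rewrite -normr_gt0.
set r0 := `|_| => r0_gt0.
pose L n := (b - a) / 2 ^+ n; pose M n := (d - c) / 2 ^+ n.
have L0 n : 0 <= L n by rewrite divr_ge0 ?subr_ge0// exprn_ge0.
have M0 n : 0 <= M n by rewrite divr_ge0 ?subr_ge0// exprn_ge0.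
have LS n : L n = L n.+1 + L n.+1 by rewrite /L exprS; field; rewrite expf_neq0.
have MS n : M n = M n.+1 + M n.+1 by rewrite /M exprS; field; rewrite expf_neq0.
pose J n (z : R * R) :=
  `|boundary_integral P Q z.1 (z.1 + L n) z.2 (z.2 + M n)|.
pose inside n (z : R * R) :=
  (a <= z.1 /\ z.1 + L n <= b) /\ (c <= z.2 /\ z.2 + M n <= d).
pose good n (z z' : R * R) :=
  ((z.1 <= z'.1 /\ z'.1 + L n.+1 <= z.1 + L n) /\
   (z.2 <= z'.2 /\ z'.2 + M n.+1 <= z.2 + M n)) /\ J n z <= 4 * J n.+1 z'.
(* One of the four quarters carries at least a fourth of the boundary integral. The premise [inside]
   sits under the existential, so that choice yields a total map. *)
have step (nz : nat * (R * R)) :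
    exists z', inside nz.1 nz.2 -> good nz.1 nz.2 z'.
  case: nz => n [x y]; have := L0 n.+1; have := M0 n.+1 => m0 l0.
  have [ins|nins] := pselect (inside n (x, y)); last by exists (x, y).
  have [[/= ax xb] [cy yd]] := ins.
  have JE : J n (x, y) <= J n.+1 (x, y) + J n.+1 (x + L n.+1, y) +
      (J n.+1 (x, y + M n.+1) + J n.+1 (x + L n.+1, y + M n.+1)).
    rewrite /J/= (@boundary_integral_split _ _ _ _ _ _ _ (x + L n.+1) (y + M n.+1)).
    - rewrite -!(addrA x) -!(addrA y) -LS -MS.
      by rewrite (le_trans (ler_normD _ _))// lerD// ler_normD.
    - move=> x' y' /andP[xx' x'b] /andP[yy' y'd]; apply: PQ.
      + by rewrite (le_trans ax xx') (le_trans x'b xb).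
      + by rewrite (le_trans cy yy') (le_trans y'd yd).
    - by have LSn := LS n; apply/andP; split; lra.
    - by have MSn := MS n; apply/andP; split; lra.
  have [le1|gt1] := leP (J n (x, y)) (4 * J n.+1 (x, y)).
    by exists (x, y) => _; split => //=; rewrite !lexx (LS n) (MS n) ?lerD2l ?lerDl ?l0 ?m0.
  have [le2|gt2] := leP (J n (x, y)) (4 * J n.+1 (x + L n.+1, y)).
    by exists (x + L n.+1, y) => _; split => //=; rewrite !lexx (LS n) (MS n) -?addrA ?lerD2l ?lerDl ?l0 ?m0.
  have [le3|gt3] := leP (J n (x, y)) (4 * J n.+1 (x, y + M n.+1)).
    by exists (x, y + M n.+1) => _; split => //=; rewrite !lexx (LS n) (MS n) -?addrA ?lerD2l ?lerDl ?l0 ?m0.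
  have [le4|gt4] := leP (J n (x, y)) (4 * J n.+1 (x + L n.+1, y + M n.+1)).
    by exists (x + L n.+1, y + M n.+1) => _; split => //=; rewrite (LS n) (MS n) -?addrA ?lexx ?lerDl ?l0 ?m0.
  by exfalso; lra.
have [g gP] := boolp.choice step.
pose z_ := fix z n := if n is n'.+1 then g (n', z n') else (a, c).
have z_in n : inside n (z_ n).
  elim: n => [|n IH].
    by rewrite /inside /L /M /= expr0 !divr1 !subrKC !lexx.
  have [[[] ? ? [] ? ?] _] := gP (n, z_ n) IH.
  have [[? ?] [? ?]] := IH.
  by split; split; apply: le_trans; eassumption.
have z_good n : good n (z_ n) (z_ n.+1) := gP (n, z_ n) (z_in n).
have J_le n : r0 <= 4 ^+ n * J n (z_ n).
  elim: n => [|n IH].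
    by rewrite expr0 mul1r /J /L /M /= expr0 !divr1 !subrKC.
  rewrite (le_trans IH)// exprSr -mulrA ler_wpM2l ?exprn_ge0//.
  by have [] := z_good n.
have mono m n : (m <= n)%N ->
    ((z_ m).1 <= (z_ n).1 /\ (z_ n).1 + L n <= (z_ m).1 + L m) /\
    ((z_ m).2 <= (z_ n).2 /\ (z_ n).2 + M n <= (z_ m).2 + M m).
  elim: n => [|n IH]; first by rewrite leqn0 => /eqP ->; rewrite !lexx.
  rewrite leq_eqVlt => /predU1P[->|]; first by rewrite !lexx.
  rewrite ltnS => /IH[[? ?] [? ?]].
  have [[[] ? ? [] ? ?] _] := z_good n.
  by split; split; apply: le_trans; eassumption.
(* The nested rectangles shrink to the point [(X, Y)], the supremum of their lower left corners. *)
pose X := sup (range (fun n => (z_ n).1)).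
pose Y := sup (range (fun n => (z_ n).2)).
have zX n : (z_ n).1 <= X /\ X <= (z_ n).1 + L n.
  have ub : ubound (range (fun n => (z_ n).1)) ((z_ n).1 + L n).
    move=> _ [m _ <-]; have [mn|/ltnW nm] := leqP m n.
      have [[h1 _] _] := mono _ _ mn.
      by rewrite (le_trans h1)// lerDl.
    by have [[_ h1] _] := mono _ _ nm; rewrite (le_trans _ h1)// lerDl.
  split; last by apply: ge_sup => //; exists (z_ 0).1; exists 0.
  by apply: ub_le_sup; [exists ((z_ n).1 + L n)|exists n].
have zY n : (z_ n).2 <= Y /\ Y <= (z_ n).2 + M n.
  have ub : ubound (range (fun n => (z_ n).2)) ((z_ n).2 + M n).
    move=> _ [m _ <-]; have [mn|/ltnW nm] := leqP m n.
      have [_ [h1 _]] := mono _ _ mn.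
      by rewrite (le_trans h1)// lerDl.
    by have [_ [_ h1]] := mono _ _ nm; rewrite (le_trans _ h1)// lerDl.
  split; last by apply: ge_sup => //; exists (z_ 0).2; exists 0.
  by apply: ub_le_sup; [exists ((z_ n).2 + M n)|exists n].
have PQXY : closed_form_at P Q X Y.
  have [? ?] := zX 0; have [? ?] := zY 0; have [[? ?] [? ?]] := z_in 0.
  by apply: PQ; apply/andP; split; apply: le_trans; eassumption.
have [p [q [r diff]]] := PQXY.
pose l := (b - a) + (d - c).
have l0 : 0 <= l by rewrite addr_ge0 ?subr_ge0.
(* With this value [2 e l^2 = r0 l^2 / (2 (l^2 + 1)) < r0]; the [+ 1] covers [l = 0]. *)
pose e := r0 / (4 * (l ^+ 2 + 1)).
have l21 : 0 < l ^+ 2 + 1 by rewrite ltr_wpDl// sqr_ge0.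
have e0 : 0 < e by rewrite divr_gt0// mulr_gt0.
have [h h0 hPQ] := diff _ e0.
have [n nh] := exists_half_pow_le l h0.
have LMn : L n + M n = l / 2 ^+ n by rewrite /L /M -mulrDl.
have [zX1 zX2] := zX n; have [zY1 zY2] := zY n.
have [[? ?] [? ?]] := z_in n.
have := L0 n; have := M0 n => Mn0 Ln0.
have : J n (z_ n) <= 2 * e * (L n + M n) ^+ 2.
  have -> : (L n + M n) ^+ 2 = ((z_ n).1 + L n - (z_ n).1 + ((z_ n).2 + M n - (z_ n).2)) ^+ 2.
    by congr (_ ^+ 2); ring.
  apply: (@boundary_integral_small P Q X Y p q r).
  - by rewrite zX1.
  - by rewrite zY1.
  - exact: ltW.
  - move=> x' y' /andP[? ?] /andP[? ?]; apply: PQ.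
      by apply/andP; split; apply: le_trans; eassumption.
    by apply/andP; split; apply: le_trans; eassumption.
  - move=> x' y' /andP[? ?] /andP[? ?]; apply: hPQ; rewrite (le_trans _ nh)// -LMn.
      by rewrite ler_norml; lra.
    by rewrite ler_norml; lra.
rewrite LMn => Jn.
have : r0 <= 4 ^+ n * (2 * e * (l / 2 ^+ n) ^+ 2).
  by rewrite (le_trans (J_le n))// ler_wpM2l// exprn_ge0.
(* The factor [4] lost at each bisection is exactly compensated by the quadratic smallness of the
   local bound. *)
have -> : 4 ^+ n * (2 * e * (l / 2 ^+ n) ^+ 2) = 2 * e * l ^+ 2.
  have -> : 4 = 2 ^+ 2 :> R by ring.
  by rewrite -exprM mulnC exprM; field; rewrite expf_neq0.
rewrite /e (_ : 2 * _ * _ = r0 * (l ^+ 2 / (2 * (l ^+ 2 + 1)))); last by field; rewrite gt_eqF.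
rewrite leNgt => /negP; apply.
rewrite gtr_pMr// ltr_pdivrMr ?mulr_gt0//.
by rewrite mul1r; have := sqr_ge0 l; lra.
Qed.

End Goursat.

(** * The complex exponential *)

Section Derive.
Variable K : numFieldType.
Implicit Types (f : K^o -> K^o) (z w : K).

(** Remainder form of the derivative, valid at [w = 0] too. Over an arbitrary [numFieldType] it
    applies both to the real [expR], [cos], [sin] and to functions on [R[i]]. *)
Lemma is_derive_expansion f z (l : K) : is_derive z 1 f l ->
  forall e : K, 0 < e -> exists2 d : K, 0 < d &
    forall w, `|w| <= d -> `|f (z + w) - f z - l * w| <= e * `|w|.
Proof.
move=> [df <-] e e0.
have /cvgrPdist_le /(_ _ e0) := df.
case=> d /= d0 dP; exists (d / 2); first by rewrite divr_gt0.
move=> w wd; have [->|w0] := eqVneq w 0.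
  by rewrite addr0 subrr mulr0 subr0 normr0 mulr0.
have := dP w; rewrite /ball_/= sub0r normrN => /(_ (le_lt_trans wd _)).
have -> : d / 2 < d by rewrite ltr_pdivrMr// ltr_pMr// ltr1n.
move=> /(_ isT w0); rewrite /GRing.scale/= mulr1 => le_e.
rewrite (_ : f (z + w) - f z - _ = - (('D_1 f z : K^o) - w^-1 * (f (w + z) - f z)) * w); last first.
  rewrite mulNr mulrBl mulrAC mulVf// mul1r (addrC w z).
  by rewrite opprB.
by rewrite normrM normrN ler_wpM2r.
Qed.

Lemma expansion_derivable f z (l : K) :
  (forall e : K, 0 < e -> exists2 d : K, 0 < d &
    forall w, `|w| <= d -> `|f (z + w) - f z - l * w| <= e * `|w|) ->
  is_derive z 1 f l.
Proof.
move=> ex.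
suff cv : (fun h : K^o => h^-1 *: ((f \o shift z) (h *: 1) - f z)) @ 0^' --> (l : K^o).
  by apply: DeriveDef; [apply/cvg_ex; exists l|exact: cvg_lim cv].
apply/cvgrPdist_le => e e0; have [d d0 dP] := ex e e0.
exists d => //= w; rewrite /ball_/= sub0r normrN => /ltW/dP + w0.
rewrite /GRing.scale/= mulr1 (addrC z) => h.
rewrite -(@ler_pM2r _ `|w|) ?normr_gt0// -normrM.
by rewrite mulrBl mulrAC mulVf// mul1r distrC.
Qed.

End Derive.

Section ComplexNorm.
Variable R : realType.
Implicit Types (z w : R[i]) (a : R).

Lemma normc_ge_Im z : `|complex.Im z|%:C <= `|z|.
Proof.
by rewrite normc_def lecR -sqrtr_sqr ler_wsqrtr// lerDr sqr_ge0.
Qed.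

Lemma normc_le_add z : `|z| <= (`|complex.Re z| + `|complex.Im z|)%:C.
Proof.
rewrite normc_def lecR -[leRHS]ger0_norm ?addr_ge0// -sqrtr_sqr ler_wsqrtr//.
rewrite sqrrD !real_normK ?num_real// lerD2r lerDl.
by rewrite mulrn_wge0// mulr_ge0.
Qed.

Lemma normc_real a : `|a%:C| = `|a|%:C.
Proof. by rewrite normc_def/= expr0n/= addr0 sqrtr_sqr. Qed.

Lemma ReD z w : complex.Re (z + w) = complex.Re z + complex.Re w.
Proof. by case: z w => [? ?] [? ?]. Qed.

Lemma ImD z w : complex.Im (z + w) = complex.Im z + complex.Im w.
Proof. by case: z w => [? ?] [? ?]. Qed.

Lemma ReN z : complex.Re (- z) = - complex.Re z.
Proof. by case: z. Qed.

Lemma ImN z : complex.Im (- z) = - complex.Im z.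
Proof. by case: z. Qed.

Lemma ReM z w : complex.Re (z * w) =
  complex.Re z * complex.Re w - complex.Im z * complex.Im w.
Proof. by case: z w => [? ?] [? ?]. Qed.

Lemma ImM z w : complex.Im (z * w) =
  complex.Re z * complex.Im w + complex.Im z * complex.Re w.
Proof. by case: z w => [? ?] [? ?]. Qed.

End ComplexNorm.

Section Cexp.
Variable R : realType.
Implicit Types (z w : R[i]).

Lemma cexpD z w : cexp (z + w) = cexp z * cexp w.
Proof.
apply/eqP; rewrite eq_complex /cexp !ReM !ImM !ReD !ImD/= expRD cosD sinD.
by apply/andP; split; apply/eqP; ring.
Qed.

Lemma normc_cexp z : `|cexp z| = (expR (complex.Re z))%:C.
Proof.
rewrite /cexp normrM normc_real (@ger0_norm _ (expR _)) ?expR_ge0//.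
by rewrite normc_def/= cos2Dsin2 sqrtr1 mulr1.
Qed.

(** By [cexpD] the expansion at [z] is [cexp z] times the expansion at [0], which follows from those
    of [expR], [cos] and [sin] at [0]. *)
Lemma is_derive_cexp z : is_derive (z : R[i]^o) 1 (@cexp R : R[i]^o -> R[i]^o) (cexp z).
Proof.
apply: expansion_derivable => e; case: e => e e'; rewrite ltcE/= => /andP[/eqP -> {e'} e0].
(* Here [14 = 2 * 7]: the errors [E1] and [E2] below add up to at most [7 m1 (|p| + |q|)], and
   [|p| + |q| <= 2 |p + i q|]. The factor [expR (Re z)] is the modulus of [cexp z]. *)
pose m := e / (14 * expR (complex.Re z)).
have m0 : 0 < m by rewrite divr_gt0// mulr_gt0// expR_gt0.
pose m1 := Num.min m 1.
have m10 : 0 < m1 by rewrite lt_min m0 ltr01.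
have m11 : m1 <= 1 by rewrite ge_min lexx orbT.
have m1m : m1 <= m by rewrite ge_min lexx.
have ex (f : R -> R) (l : R) : is_derive (0 : R) 1 f l -> exists2 d : R, 0 < d &
    forall w : R, `|w| <= d -> `|f w - f 0 - l * w| <= m1 * `|w|.
  move=> df; have [d d0 dP] := is_derive_expansion df m10.
  by exists d => // w /dP; rewrite add0r.
have [d1 d10 exp_] := ex _ _ (is_derive_expR 0).
have [d2 d20 cos_] := ex _ _ (is_derive_cos 0).
have [d3 d30 sin_] := ex _ _ (is_derive_sin 0).
pose d := Num.min (Num.min d1 d2) (Num.min d3 (m1 / 2)).
have d0 : 0 < d by rewrite !lt_min d10 d20 d30 divr_gt0.
have [dd1 dd2 dd3 ddm] : [/\ d <= d1, d <= d2, d <= d3 & d <= m1 / 2].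
  by rewrite /d; split; rewrite !ge_min !lexx ?orbT.
exists d%:C; first by rewrite ltcR.
case=> p q pqd.
have pd : `|p| <= d by rewrite -lecR (le_trans _ pqd)// (normc_ge_Re (p +i* q)).
have qd : `|q| <= d by rewrite -lecR (le_trans _ pqd)// (normc_ge_Im (p +i* q)).
have := exp_ p (le_trans pd dd1); have := cos_ q (le_trans qd dd2).
have := sin_ q (le_trans qd dd3).
rewrite !(expR0, cos0, sin0) oppr0 mul0r mul1r !subr0 mul1r ?addr0.
set ep := expR p; set cq := cos q; set sq := sin q => hs hc he.
have E1 : `|ep * cq - 1 - p| <= m1 * `|p| + 3 * (m1 * `|q|).
  rewrite (_ : _ - _ = (ep - 1 - p) + ep * (cq - 1)); last by ring.
  rewrite (le_trans (ler_normD _ _))// lerD// normrM ler_pM//.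
  rewrite (_ : ep = (ep - 1 - p) + (1 + p)); last by ring.
  rewrite (le_trans (ler_normD _ _))//.
  have := ler_normD 1 p; rewrite normr1.
  have : m1 * `|p| <= `|p| by rewrite ler_piMl.
  by lra.
have E2 : `|ep * sq - q| <= 4 * (m1 * `|q|).
  rewrite (_ : _ - _ = ep * (sq - q) + (ep - 1) * q); last by ring.
  have ep1 : `|ep - 1| <= m1.
    rewrite (_ : ep - 1 = (ep - 1 - p) + p); last by ring.
    rewrite (le_trans (ler_normD _ _))//.
    have : m1 * `|p| <= `|p| by rewrite ler_piMl.
    by lra.
  have ep3 : `|ep| <= 3.
    rewrite (_ : ep = (ep - 1) + 1); last by ring.
    by rewrite (le_trans (ler_normD _ _))// normr1; lra.
  have s1 : `|ep * (sq - q)| <= 3 * (m1 * `|q|) by rewrite normrM ler_pM.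
  have s2 : `|(ep - 1) * q| <= m1 * `|q| by rewrite normrM ler_wpM2r.
  by rewrite (le_trans (ler_normD _ _))//; lra.
rewrite cexpD (_ : _ - _ - _ = cexp z * (cexp (p +i* q) - 1 - (p +i* q))); last by ring.
rewrite normrM normc_cexp.
have : `|cexp (p +i* q) - 1 - (p +i* q)| <= (7 * m1)%:C * (`|p| + `|q|)%:C.
  apply: le_trans (normc_le_add _) _.
  have -> : complex.Re (cexp (p +i* q) - 1 - (p +i* q)) = ep * cq - 1 - p.
    by rewrite /cexp/= -/ep -/cq -/sq; ring.
  have -> : complex.Im (cexp (p +i* q) - 1 - (p +i* q)) = ep * sq - q.
    by rewrite /cexp/= -/ep -/cq -/sq; ring.
  rewrite -rmorphM lecR; apply: le_trans (lerD E1 E2) _.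
  have : 0 <= m1 * `|p| by rewrite mulr_ge0// ltW.
  by rewrite mulrDr; lra.
set c := `|cexp _ - _ - _| => hc'.
have hpq : (`|p| + `|q|)%:C <= 2 * `|p +i* q|.
  rewrite rmorphD/= mulr2n mulrDl !mul1r lerD//.
    exact: (normc_ge_Re (p +i* q)).
  exact: (normc_ge_Im (p +i* q)).
have e7 : (expR (complex.Re z))%:C * (7 * m1)%:C * 2 <= e%:C.
  rewrite (_ : _ * _ * 2 = (expR (complex.Re z) * (7 * m1) * 2)%:C) ?lecR; last first.
    by rewrite !rmorphM !rmorph_nat.
  apply: le_trans (_ : expR (complex.Re z) * (7 * m) * 2 <= _).
    by rewrite ler_wpM2r// ler_wpM2l ?expR_ge0// ler_wpM2l.
  rewrite le_eqVlt; apply/orP; left; apply/eqP; rewrite /m; field.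
  by rewrite gt_eqF// expR_gt0.
apply: le_trans (_ : (expR (complex.Re z))%:C * ((7 * m1)%:C * (2 * `|p +i* q|)) <= _).
  rewrite ler_wpM2l ?lecR ?expR_ge0// (le_trans hc')// ler_wpM2l//.
  by rewrite lecR mulr_ge0// ltW.
by rewrite !mulrA ler_wpM2r.
Qed.

(** The form with these coefficients is the imaginary part of [H dz], and its closedness is the
    Cauchy-Riemann equations: if the derivative is [l + i l'], then [P_x = l'], [P_y = Q_x = l] and
    [Q_y = - l']. Along vertical sides it integrates [Re H]. *)
Lemma derivable_closed_form (H : R[i] -> R[i]) (x y : R) :
  derivable (H : R[i]^o -> R[i]^o) (x +i* y) 1 ->
  closed_form_at (fun x y => complex.Im (H (x +i* y)))
                 (fun x y => complex.Re (H (x +i* y))) x y.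
Proof.
move=> dH; have := is_derive_expansion (DeriveDef dH erefl).
move: (derive _ _ _) => [l l'] lP.
exists l', l, (- l') => e e0; have /lP[] : 0 < (e%:C : R[i]) by rewrite ltcR.
case=> d d' + dP; rewrite ltcE/= => /andP[/eqP d'0 d0].
exists (d / 2); first by rewrite divr_gt0.
move=> x' y' xd yd; have := dP ((x' - x) +i* (y' - y)).
have -> : (x +i* y) + ((x' - x) +i* (y' - y)) = x' +i* y'.
  by apply/eqP; rewrite eq_complex/= !subrKC !eqxx.
have wd := normc_le_add ((x' - x) +i* (y' - y)).
have -> : `|(x' - x) +i* (y' - y)| <= d +i* d'.
  apply: le_trans wd _; rewrite d'0 lecR/=.
  by lra.
move=> /(_ isT) hH.
have {}hH : `|H (x' +i* y') - H (x +i* y) - (l +i* l') * ((x' - x) +i* (y' - y))|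
   <= (e * (`|x' - x| + `|y' - y|))%:C.
  rewrite (le_trans hH)// rmorphM/= ler_wpM2l//.
  by rewrite lecR ltW.
split; rewrite -lecR; apply: le_trans hH.
- apply: le_trans (normc_ge_Im _); rewrite lecR !(ImD, ImN, ImM)/=.
  by rewrite le_eqVlt; apply/orP; left; apply/eqP; congr `|_|; ring.
- apply: le_trans (normc_ge_Re _); rewrite lecR !(ReD, ReN, ReM)/=.
  by rewrite le_eqVlt; apply/orP; left; apply/eqP; congr `|_|; ring.
Qed.

End Cexp.

(** * Shifting vertical contours *)

Section ContourShift.
Variable R : realType.
Local Notation mu := (@lebesgue_measure R).

Lemma cvg_Rintegral_itvNn (f : R -> R) : mu.-integrable [set: R] (EFin \o f) ->
  (\int[mu]_(x in `[- n%:R, n%:R]) f x) @[n --> \oo] --> \int[mu]_x f x.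
Proof.
move=> intf.
pose f_ (n : nat) := (EFin \o f) \_ (`[- n%:R, n%:R]%classic : set R).
have mf := measurable_int mu intf.
have h := @dominated_convergence _ _ R mu setT measurableT f_ (EFin \o f)
  (abse \o (EFin \o f)).
rewrite /Rintegral; apply: fine_cvg; rewrite fineK; last exact: integrable_fin_num.
under eq_fun do rewrite integral_mkcond.
have mf_ n : measurable_fun [set: R] (f_ n).
  apply/(measurable_restrictT _ _).1 => //.
  exact: measurable_funTS.
have f_f : {ae mu, forall x, [set: R] x -> f_ ^~ x @ \oo --> (EFin \o f) x}.
  apply: aeW => x _; apply: cvg_near_cst; near=> n.
  rewrite /f_ patchE mem_set//= in_itv/= -ler_norml.
  by near: n; exact: nbhs_infty_ger.
have f_g : {ae mu, forall x n, [set: R] x -> (`|f_ n x| <= (abse \o (EFin \o f)) x)%E}.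
  apply: aeW => x n _; rewrite /f_ patchE; case: ifPn => //= _.
  by rewrite normr0 lee_fin.
by have [] := h mf_ mf f_f (integrable_abse intf) f_g.
Unshelve. all: by end_near. Qed.

(** The horizontal sides at heights [n] and [- n] contribute at most [c |D n|] each and vanish in
    the limit. The bound by [D] is asked only on the two vertical lines and for large [|y|], because
    [h] is assumed bounded only outside a disc about [alpha]. *)
Lemma contour_shift (H : R[i] -> R[i]) (D : R -> R) (c T0 : R) : 0 <= c ->
  (forall x y, 0 <= x <= c -> derivable (H : R[i]^o -> R[i]^o) (x +i* y) 1) ->
  mu.-integrable [set: R] (EFin \o D) -> (forall y, D (- y) = D y) ->
  D n%:R @[n --> \oo] --> (0 : R) ->
  (forall x y, 0 <= x <= c -> [|| x == 0, x == c | T0 <= `|y|] ->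
    `|H (x +i* y)| <= (D y)%:C) ->
  \int[mu]_y complex.Re (H (0 +i* y)) = \int[mu]_y complex.Re (H (c +i* y)).
Proof.
move=> c0 dH intD evenD D0 HD.
pose P (x y : R) := complex.Im (H (x +i* y)).
pose Q (x y : R) := complex.Re (H (x +i* y)).
have PQ x y : 0 <= x <= c -> closed_form_at P Q x y.
  by move=> xc; apply: derivable_closed_form; exact: dH.
have c00 : (0 : R) <= 0 <= c by rewrite lexx.
have ccc : 0 <= c <= c by rewrite lexx andbT.
have intQ x : 0 <= x <= c -> (x == 0) || (x == c) ->
    mu.-integrable [set: R] (EFin \o Q x).
  move=> xc x0c; apply: le_integrable intD => //.
    apply/measurable_EFinP; apply: continuous_measurable_fun => y.
    by have [] := closed_form_continuous (PQ x y xc).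
  move=> y _ /=; rewrite lee_fin (le_trans _ (ler_norm _))// -lecR.
  by rewrite (le_trans (normc_ge_Re _))// HD// orbA x0c.
have cA := cvg_Rintegral_itvNn (intQ 0 c00 _).
have cB := cvg_Rintegral_itvNn (intQ c ccc _).
rewrite eqxx in cA; rewrite eqxx orbT in cB.
have {}cA := cA isT; have {}cB := cB isT.
apply/eqP; rewrite -subr_eq0; apply/eqP.
rewrite -(cvg_lim (@norm_hausdorff _ _) (cvgB cA cB)).
apply: cvg_lim; first exact: norm_hausdorff.
apply/cvgr0Pnorm_le => e e0.
have c21 : 0 < 2 * c + 1 by lra.
near=> n.
(* The two horizontal sides contribute at most [2 c |D n|]; the [+ 1] covers [c = 0]. *)
have Dn : `|D n%:R| <= e / (2 * c + 1).
  by near: n; move/cvgr0Pnorm_le: D0; apply; rewrite divr_gt0.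
have nT0 : T0 <= n%:R by near: n; exact: nbhs_infty_ger.
have nn : - n%:R <= n%:R :> R by rewrite -subr_ge0 opprK addr_ge0.
have := goursat c0 nn (fun x y hx _ => PQ x y hx).
rewrite /boundary_integral.
have small y : T0 <= `|y| -> D y = D n%:R ->
    `|\int[mu]_(x in `[0, c]) P x y| <= `|D n%:R| * c.
  move=> Ty Dy.
  have cP x : 0 <= x <= c -> {for x, continuous (P ^~ y)}.
    by move=> xc; have [] := closed_form_continuous (PQ x y xc).
  have := @Rintegral_near_affine R (P ^~ y) 0 0 `|D n%:R| 0 c c0 cP.
  rewrite !mul0r !add0r subr0 subr0; apply => x xc.
  rewrite mul0r addr0 subr0 (le_trans _ (ler_norm _))// -lecR (le_trans (normc_ge_Im _))//.
  by rewrite -Dy HD// Ty !orbT.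
have h1 : `|\int[mu]_(x in `[0, c]) P x (- n%:R)| <= `|D n%:R| * c.
  by apply: small; rewrite ?normrN ?evenD// (le_trans nT0)// ler_norm.
have h2 : `|\int[mu]_(x in `[0, c]) P x n%:R| <= `|D n%:R| * c.
  by apply: small; rewrite // (le_trans nT0)// ler_norm.
set I1 := \int[mu]_(x in _) P x _; set I2 := \int[mu]_(x in _) P x _.
move: h1 h2; rewrite -/I1 -/I2.
set I3 := \int[mu]_(x in _) Q c x; set I4 := \int[mu]_(x in _) Q 0 x.
move=> h1 h2 /eqP h.
change (`|I4 - I3| <= e).
have -> : I4 - I3 = I1 - I2 by apply/eqP; rewrite -subr_eq0 -oppr_eq0; apply: etrans h; congr (_ == 0); ring.
rewrite (le_trans (ler_normB _ _))// (le_trans (lerD h1 h2))//.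
rewrite -mulrDl -mulr2n.
move: Dn; rewrite ler_pdivlMr// => Dn; apply: le_trans Dn.
by rewrite -subr_ge0 (_ : _ - _ = `|D n%:R|)//; ring.
Unshelve. all: by end_near. Qed.

End ContourShift.

(** * Fourier transforms of Gaussians *)

Section Gaussian.
Variable R : realType.
Local Notation mu := (@lebesgue_measure R).
Implicit Types (s x y u a b : R).

(** Characteristic function of the centred normal law of deviation [s]. Up to a constant it is also
    the normal density of deviation [s^-1], which gives its integral. *)
Definition gauss s y : R := expR (- (s ^+ 2 * y ^+ 2 / 2)).

Lemma gaussE s y : s != 0 -> gauss s y = (normal_peak s^-1)^-1 * normal_pdf 0 s^-1 y.
Proof.
move=> s0; rewrite normal_pdfE ?invr_eq0//= mulKf; last first.
  by rewrite gt_eqF// normal_peak_gt0// invr_eq0.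
rewrite /gauss /normal_fun subr0; congr expR.
by field.
Qed.

Lemma integrable_gauss s : s != 0 -> mu.-integrable [set: R] (EFin \o gauss s).
Proof.
move=> s0.
rewrite (_ : _ \o _ = fun y => ((normal_peak s^-1)^-1%:E * (normal_pdf 0 s^-1 y)%:E)%E); last first.
  by apply/funext => y /=; rewrite gaussE.
by apply: integrableZl => //; exact: integrable_normal_pdf.
Qed.

Lemma Rintegral_gauss s : s != 0 ->
  \int[mu]_y gauss s y = (normal_peak s^-1)^-1.
Proof.
move=> s0; under eq_Rintegral do rewrite gaussE//.
rewrite RintegralZl//; last exact: integrable_normal_pdf.
by rewrite /Rintegral integral_normal_pdf mulr1.
Qed.

Lemma gaussN s y : gauss s (- y) = gauss s y.
Proof. by rewrite /gauss sqrrN. Qed.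

Lemma gauss_ge0 s y : 0 <= gauss s y. Proof. exact: expR_ge0. Qed.

Lemma continuous_gauss s : continuous (gauss s).
Proof.
move=> y; apply: (@cvg_comp _ _ _ _ expR); last exact: continuous_expR.
apply: cvgN; apply: cvgM; last exact: cvg_cst.
by apply: cvgM; [exact: cvg_cst|exact: exprn_continuous].
Qed.

Lemma cvg_expRN (c : R) : 0 < c -> expR (- (c * n%:R)) @[n --> \oo] --> (0 : R).
Proof.
move=> c0; apply/cvgr0Pnorm_le => e e0; near=> n.
rewrite ger0_norm ?expR_ge0// expRN.
have n0 : (0 < n%:R :> R) by rewrite ltr0n; near: n; exact: nbhs_infty_gt.
apply: (@le_trans _ _ (c * n%:R)^-1).
  rewrite lef_pV2 ?posrE ?expR_gt0 ?mulr_gt0//.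
  by rewrite (le_trans _ (expR_ge1Dx _))// lerDr.
rewrite invf_ple ?posrE ?mulr_gt0// mulrC -ler_pdivrMr//.
by near: n; exact: nbhs_infty_ger.
Unshelve. all: by end_near. Qed.

Lemma cvg_gauss s : s != 0 -> gauss s n%:R @[n --> \oo] --> (0 : R).
Proof.
move=> s0; have s20 : 0 < s ^+ 2 / 2 by rewrite divr_gt0// exprn_even_gt0.
apply: (@squeeze_cvgr _ _ _ _ (fun=> 0) (fun n => expR (- (s ^+ 2 / 2 * n%:R)))).
- near=> n; rewrite gauss_ge0 ler_expR lerN2 (mulrAC _ (n%:R ^+ 2)).
  apply: ler_wpM2l; first exact: ltW.
  by rewrite -natrX ler_nat -[leqLHS]expn1 leq_pexp2l//; near: n; exact: nbhs_infty_gt.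
- exact: cvg_cst.
- exact: cvg_expRN.
Unshelve. all: by end_near. Qed.

(** Kernel of the contour integrals: [a = s^2 / 2] throughout, with [b = x] for smoothing at [x] and
    [b = 0] in [fourier_gauss]. *)
Definition cgauss a b (z : R[i]) : R[i] := cexp (a%:C * z ^+ 2 - b%:C * z).

Lemma derivable_cgauss a b (z : R[i]) :
  derivable (cgauss a b : R[i]^o -> R[i]^o) z 1.
Proof.
apply/derivable1_diffP.
apply: (@differentiable_comp _ _ _ _ (fun z : R[i]^o => a%:C * z ^+ 2 - b%:C * z : R[i]^o)
   (@cexp R : R[i]^o -> R[i]^o)).
  apply/derivable1_diffP.
  by apply: derivableB; apply: derivableM => //; apply: derivableX.
by apply/derivable1_diffP; case: (is_derive_cexp (a%:C * z ^+ 2 - b%:C * z)).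
Qed.

Lemma cgaussE a b x y : cgauss a b (x +i* y) =
  (expR (a * (x ^+ 2 - y ^+ 2) - b * x))%:C *
  (cos (2 * a * x * y - b * y) +i* sin (2 * a * x * y - b * y)).
Proof.
rewrite /cgauss /cexp; congr ((expR _)%:C * (cos _ +i* sin _)) => /=; ring.
Qed.

Lemma normc_cgauss a b x y : `|cgauss a b (x +i* y)| =
  (expR (a * (x ^+ 2 - y ^+ 2) - b * x))%:C.
Proof.
rewrite cgaussE normrM normc_real (@ger0_norm _ (expR _)) ?expR_ge0//.
by rewrite normc_def/= cos2Dsin2 sqrtr1 mulr1.
Qed.

Lemma integrable_bounded_gauss (F : R -> R) s u : s != 0 ->
  continuous F -> (forall x, `|F x| <= 1) ->
  mu.-integrable [set: R] (EFin \o (fun y => F (y * u) * gauss s y)).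
Proof.
move=> s0 cF F1; apply: le_integrable (integrable_gauss s0) => //.
  apply/measurable_EFinP; apply: continuous_measurable_fun => y.
  apply: cvgM; last exact: continuous_gauss.
  apply: (@cvg_comp _ _ _ _ F); last exact: cF.
  by apply: cvgM; [exact: cvg_id|exact: cvg_cst].
by move=> y _ /=; rewrite lee_fin normrM ler_piMl.
Qed.

Lemma normr_cos x : `|cos x| <= 1.
Proof. by rewrite ler_norml cos_geN1 cos_le1. Qed.

Lemma normr_sin x : `|sin x| <= 1.
Proof. by rewrite ler_norml sin_geN1 sin_le1. Qed.

(** On the line [Re z = c] with [c = u / s^2], the function [exp(s^2 z^2 / 2)] equals
    [exp(u^2 / (2 s^2)) exp(i u y) gauss s y], and its integral is the same as on the imaginary
    axis. The factors [1] and [- i] extract real and imaginary parts. *)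
Lemma fourier_gauss s u : s != 0 ->
  \int[mu]_y (cos (y * u) * gauss s y) =
    (normal_peak s^-1)^-1 * expR (- (u ^+ 2 / (s ^+ 2 *+ 2))) /\
  \int[mu]_y (sin (y * u) * gauss s y) = 0.
Proof.
move=> s0.
have icos v := integrable_bounded_gauss v s0 (@continuous_cos R) normr_cos.
have isin v := integrable_bounded_gauss v s0 (@continuous_sin R) normr_sin.
(* [contour_shift] moves the line to the right only; parity reduces to this case. *)
wlog u0 : u / 0 <= u => [hw|].
  have [/hw//|/ltW u0] := leP 0 u.
  have [] := hw (- u); first by rewrite oppr_ge0.
  rewrite sqrrN => <- h; split.
    by apply: eq_Rintegral => y _; rewrite mulrN cosN.
  apply/eqP; rewrite -oppr_eq0 -mulN1r -RintegralZl// -h; apply/eqP.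
  by apply: eq_Rintegral => y _; rewrite mulrN sinN !mulNr mul1r.
have s20 : 0 < s ^+ 2 by rewrite exprn_even_gt0.
pose a := s ^+ 2 / 2; pose c := u / s ^+ 2.
have c0 : 0 <= c by rewrite divr_ge0// ltW.
have a0 : 0 <= a by rewrite divr_ge0// ltW.
pose D y := expR (a * c ^+ 2) * gauss s y.
have shift (th : R[i]) : `|th| <= 1 ->
    \int[mu]_y complex.Re (th * cgauss a 0 (0 +i* y)) =
    \int[mu]_y complex.Re (th * cgauss a 0 (c +i* y)).
  move=> th1; apply: (@contour_shift R (fun z => th * cgauss a 0 z) D c 0) => //.
  - move=> x y _; apply: derivableM; first exact: derivable_cst.
    exact: derivable_cgauss.
  - exact: (integrableZl measurableT (expR (a * c ^+ 2)) (integrable_gauss s0)).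
  - by move=> y; rewrite /D gaussN.
  - by rewrite -(mulr0 (expR (a * c ^+ 2))); apply: cvgM; [exact: cvg_cst|exact: cvg_gauss].
  - move=> x y /andP[x0 xc] _; rewrite normrM normc_cgauss.
    rewrite -[leRHS]mul1r; apply: ler_pM => //; first by rewrite lecR expR_ge0.
    rewrite lecR /D /gauss -expRD ler_expR mul0r subr0.
    rewrite mulrBr; apply: lerB; last by rewrite /a mulrAC.
    by rewrite ler_wpM2l// ler_pXn2r.
have E0 : expR (a * c ^+ 2) = expR (u ^+ 2 / (s ^+ 2 *+ 2)).
  by congr expR; rewrite /a /c; field.
have Ec y : a * (c ^+ 2 - y ^+ 2) - 0 * c = a * c ^+ 2 + - (s ^+ 2 * y ^+ 2 / 2).
  by rewrite /a; field.
have Eu y : 2 * a * c * y - 0 * y = y * u by rewrite /a /c; field.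
have re1 (e p q : R) : complex.Re (1 * (e%:C * (p +i* q))) = e * p.
  by rewrite mul1r /=; ring.
have re2 (e p q : R) : complex.Re ((0 -i* 1) * (e%:C * (p +i* q))) = e * q.
  by rewrite /=; ring.
have a0y y : a * (0 ^+ 2 - y ^+ 2) - 0 * 0 = - (s ^+ 2 * y ^+ 2 / 2).
  by rewrite /a; field.
have b0y y : 2 * a * 0 * y - 0 * y = 0 by ring.
split.
- have := shift 1; rewrite normr1 => /(_ (lexx _)).
  under eq_Rintegral do rewrite cgaussE re1 a0y b0y cos0 mulr1 -/(gauss _ _).
  under [X in _ = X -> _]eq_Rintegral do
    rewrite cgaussE re1 Ec Eu expRD -/(gauss _ _) -mulrA (mulrC (gauss _ _)).
  rewrite Rintegral_gauss// RintegralZl// E0 => ->.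
  by rewrite mulrAC -expRD subrr expR0 mul1r.
- have := shift (0 -i* 1).
  rewrite (_ : `|0 -i* 1| = 1) => [/(_ (lexx _))|]; last first.
    by rewrite normc_def/= expr0n sqrrN expr1n add0r sqrtr1.
  under eq_Rintegral do rewrite cgaussE re2 a0y b0y sin0 mulr0.
  under [X in _ = X -> _]eq_Rintegral do
    rewrite cgaussE re2 Ec Eu expRD -/(gauss _ _) -mulrA (mulrC (gauss _ _)).
  rewrite RintegralZl// E0 Rintegral_cst// mul0r => /esym/eqP.
  by rewrite mulf_eq0 gt_eqF ?expR_gt0//= => /eqP.
Qed.

(* For [F = cos] and [F = sin] the inner integral on the right is given by
   [fourier_gauss]. *)
Lemma fubini_gauss (m : {sigma_finite_measure set (measurableTypeR R) -> \bar R})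
    (w F : R -> R) s x : s != 0 -> m.-integrable [set: R] (EFin \o w) ->
  continuous F -> (forall x, `|F x| <= 1) ->
  mu.-integrable [set: R] (EFin \o (fun y => (\int[m]_t (w t * F (y * (t - x)))) * gauss s y)) /\
  \int[mu]_y ((\int[m]_t (w t * F (y * (t - x)))) * gauss s y) =
  \int[m]_t (w t * \int[mu]_y (F (y * (t - x)) * gauss s y)).
Proof.
move=> s0 intw cF F1.
have mw : measurable_fun [set: measurableTypeR R] w.
  by apply/measurable_EFinP; exact: measurable_int intw.
pose f (z : measurableTypeR R * measurableTypeR R) : \bar R :=
  (w z.2 * F (z.1 * (z.2 - x)) * gauss s z.1)%:E.
have mF : measurable_fun [set: measurableTypeR R] F by exact: continuous_measurable_fun.
have mg : measurable_fun [set: measurableTypeR R] (gauss s).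
  by apply: continuous_measurable_fun; exact: continuous_gauss.
have mf : measurable_fun setT f.
  apply/measurable_EFinP; apply: measurable_funM; first apply: measurable_funM.
  - exact: (measurableT_comp mw).
  - apply: (measurableT_comp mF).
    by apply: measurable_funM => //; apply: measurable_funB.
  - exact: (measurableT_comp mg).
have intFt y : m.-integrable [set: R] (EFin \o (fun t => w t * F (y * (t - x)))).
  apply: le_integrable intw => //.
    apply/measurable_EFinP; apply: measurable_funM => //.
    apply: (measurableT_comp mF).
    by apply: measurable_funM => //; apply: measurable_funB.
  by move=> t _ /=; rewrite lee_fin normrM ler_piMr.
have intf : (mu \x m)%E.-integrable setT f.
  apply/integrable12ltyP => //.
  apply: (@le_lt_trans _ _ (\int[mu]_y ((\int[m]_t `|w t|)%:E * (gauss s y)%:E))%E).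
    apply: ge0_le_integral => //.
    - by move=> y _; apply: integral_ge0.
    - apply: (measurable_fun_fubini_tonelli_F (abse \o f)) => //=.
      exact: measurableT_comp.

    - by apply/measurable_EFinP; apply: measurable_funM => //.
    - move=> y _; rewrite /f /= muleC.
      have intaw : m.-integrable [set: R] (EFin \o (fun t => `|w t|)).
        exact: (integrable_abse intw).
      rewrite /Rintegral fineK; last exact: integrable_fin_num.
      rewrite -integralZl//; apply: ge0_le_integral => //.
      - by apply/measurable_EFinP; apply: measurableT_comp => //; apply: measurable_funM => //;
          apply/measurable_EFinP; exact: measurable_int (intFt y).
      - by apply/measurable_EFinP; apply: measurable_funM => //; apply: measurableT_comp.
      - move=> t _; rewrite -EFinM lee_fin !normrM mulrC (ger0_norm (gauss_ge0 _ _)).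
        by rewrite ler_wpM2l ?gauss_ge0// ler_piMr.
  rewrite integralZl//; last exact: integrable_gauss.
  have : mu.-integrable [set: R] (EFin \o gauss s) by exact: integrable_gauss.
  move=> /integrable_fin_num => /(_ measurableT) /fineK <-.
  by rewrite -EFinM ltry.
have intFy t : mu.-integrable [set: R] (EFin \o (fun y => F (y * (t - x)) * gauss s y)).
  exact: integrable_bounded_gauss.
have FE y : (\int[m]_t f (y, t) = (\int[m]_t (w t * F (y * (t - x))) * gauss s y)%:E)%E.
  rewrite /f/= -RintegralZr// fineK//.
  exact: (integrable_fin_num _ (integrableZr _ _ (intFt y))).
have GE t : (\int[mu]_y f (y, t) = (w t * \int[mu]_y (F (y * (t - x)) * gauss s y))%:E)%E.
  rewrite /f/= -RintegralZl// fineK//.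
    by apply: eq_integral => y _; rewrite mulrA.
  exact: (integrable_fin_num _ (integrableZl _ _ (intFy t))).
have intF := integrable_fubini_F intf.
have FubE := Fubini intf.
split.
  apply: eq_integrable intF => // y _; exact: FE.
rewrite /Rintegral; congr fine.
under eq_integral do rewrite -FE.
rewrite FubE.
by apply: eq_integral => t _; rewrite GE.
Qed.

End Gaussian.

(** * Transforms of gamma densities *)

Section GammaWeight.
Variable R : realType.
Local Notation mu := (@lebesgue_measure R).
Implicit Types (a t x y : R).

(** This is [t / x <= exp(t / x - 1)] raised to the power [j]. *)
Lemma exprn_le_expR j x t : 0 < x -> 0 <= t ->
  t ^+ j <= x ^+ j * expR (j%:R / x * (t - x)).
Proof.
move=> x0 t0; rewrite mulrAC -mulrA expRM_natl -exprMn lerXn2r ?nnegrE//.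
  by rewrite mulr_ge0 ?expR_ge0// ltW.
rewrite mulrC -ler_pdivrMr// (le_trans _ (expR_ge1Dx _))//.
by rewrite mulrBl divff ?gt_eqF// addrC subrK.
Qed.

(** Gamma density of shape [j + 1] and rate [a] up to normalisation, extended by zero so that it is
    a weight on the whole line. *)
Definition gweight j a : R -> R :=
  (fun t => t ^+ j * expR (- (a * t))) \_ `[0%R, +oo[.

Lemma gweight_ge0 j a t : 0 <= gweight j a t.
Proof.
apply: restrict_ge0 => {}t /=; rewrite in_itv/= andbT => t0.
by rewrite mulr_ge0 ?exprn_ge0 ?expR_ge0.
Qed.

Lemma gweightE j a t : 0 <= t -> gweight j a t = t ^+ j * expR (- (a * t)).
Proof. by move=> t0; rewrite /gweight patchE mem_set//= in_itv/= t0. Qed.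

Lemma gweight_lt0 j a t : t < 0 -> gweight j a t = 0.
Proof.
move=> t0; rewrite /gweight patchE ifF//; apply/negP.
by rewrite inE/= in_itv/= andbT; apply/negP; rewrite -ltNge.
Qed.

(** The exponential on the right has rate [a - j / x] and touches the weight at [t = x]. It replaces
    the weight in the upper estimates of tails and Gaussian averages at [x]. *)
Lemma gweight_le j a x t : 0 < x ->
  gweight j a t <= x ^+ j * expR (- (a * x)) * expR (- ((a - j%:R / x) * (t - x))).
Proof.
move=> x0; have [t0|t0] := leP 0 t; last first.
  by rewrite gweight_lt0// !mulr_ge0 ?expR_ge0// exprn_ge0// ltW.
rewrite gweightE//; apply: le_trans (_ : x ^+ j * expR (j%:R / x * (t - x)) * expR (- (a * t)) <= _).
  by rewrite ler_wpM2r ?expR_ge0// exprn_le_expR.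
rewrite -!mulrA -!expRD le_eqVlt; apply/orP; left; apply/eqP.
by congr (_ * expR _); ring.
Qed.

Lemma measurable_gweight j a : measurable_fun [set: R] (gweight j a).
Proof.
apply/(measurable_restrictT _ _).1 => //; apply: measurable_funTS.
apply: measurable_funM; first exact: exprn_measurable.
by apply: measurableT_comp => //; apply: measurableT_comp => //; exact: measurable_funM.
Qed.

(* [x = 2 (j + 1) / a] makes the rate in [gweight_le] at least [a / 2]. *)
Lemma gweight_bound j a : 0 < a ->
  exists2 c : R, 0 <= c & forall t, gweight j a t <= c * gweight 0 (a / 2) t.
Proof.
move=> a0; pose x := 2 * (j%:R + 1) / a.
have x0 : 0 < x by rewrite divr_gt0// mulr_gt0// ltr_wpDl.
exists (x ^+ j * expR (- (a * x)) * expR ((a / 2) * x + x * a)).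
  by rewrite !mulr_ge0 ?expR_ge0// exprn_ge0// ltW.
move=> t; have [t0|t0] := leP 0 t; last by rewrite !gweight_lt0// mulr0.
rewrite (gweightE 0)// expr0 mul1r (le_trans (gweight_le _ _ _ x0))//.
rewrite -[leRHS]mulrA ler_wpM2l//.
  by rewrite mulr_ge0 ?expR_ge0// exprn_ge0// ltW.
rewrite -expRD ler_expR.
have jx : 0 <= j%:R / x by rewrite divr_ge0// ltW.
have jx2 : j%:R / x <= a / 2.
  have j1 : 0 < j%:R + 1 :> R by rewrite ltr_wpDl.
  have -> : j%:R / x = a / 2 * (j%:R / (j%:R + 1)).
    by rewrite /x; field; rewrite !gt_eqF.
  by rewrite ler_piMr// ?divr_ge0 ?(ltW a0)// ler_pdivrMr// mul1r lerDl.
have : (j%:R / x) * t <= (a / 2) * t by rewrite ler_wpM2r.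
have : 0 <= (j%:R / x) * x by rewrite mulr_ge0// ltW.
have : 0 < a * x by rewrite mulr_gt0.
by lra.
Qed.

Lemma integrable_gweight j a : 0 < a ->
  mu.-integrable [set: R] (EFin \o gweight j a).
Proof.
move=> a0; have [c c0 cP] := gweight_bound j a0.
have a20 : 0 < a / 2 by rewrite divr_gt0.
have int0 : mu.-integrable [set: R] (EFin \o gweight 0 (a / 2)).
  apply: eq_integrable (integrableZl measurableT (a / 2)^-1 (integrable_exponential_pdf a20)) => // t _.
  rewrite /= -EFinM; congr EFin; have [t0|t0] := leP 0 t; last first.
    by rewrite gweight_lt0// lt0_exponential_pdf// mulr0.
  by rewrite gweightE// exponential_pdfE// expr0 mul1r mulKf ?gt_eqF// mulNr.
apply: le_integrable (integrableZl measurableT c int0) => //.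
  by apply/measurable_EFinP; exact: measurable_gweight.
move=> t _ /=; rewrite lee_fin !ger0_norm ?gweight_ge0//.
by rewrite mulr_ge0// gweight_ge0.
Qed.

Lemma cvg_gweight j a : 0 < a -> gweight j a n%:R @[n --> \oo] --> (0 : R).
Proof.
move=> a0; have [c c0 cP] := gweight_bound j a0.
have a20 : 0 < a / 2 by rewrite divr_gt0.
apply: (@squeeze_cvgr _ _ _ _ (fun=> 0) (fun n => c * expR (- (a / 2 * n%:R)))).
- near=> n; rewrite gweight_ge0/= (le_trans (cP _))//.
  by rewrite gweightE// expr0 mul1r.
- exact: cvg_cst.
- rewrite -(mulr0 c); apply: cvgM; first exact: cvg_cst.
  exact: cvg_expRN.
Unshelve. all: by end_near. Qed.

Lemma Rintegral_derive0y (F f : R -> R) :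
  (forall t : R, is_derive t 1 F (f t)) -> continuous f ->
  mu.-integrable [set: R] (EFin \o (f \_ `[0%R, +oo[)) ->
  F n%:R @[n --> \oo] --> (0 : R) ->
  \int[mu]_t (f \_ `[0%R, +oo[) t = - F 0.
Proof.
move=> dF cf intf F0.
have cv := cvg_Rintegral_itvNn intf.
rewrite -(cvg_lim (@norm_hausdorff _ _) cv).
apply: cvg_lim; first exact: norm_hausdorff.
have : (fun n => F n%:R - F 0) @ \oo --> 0 - F 0 by apply: cvgB => //; exact: cvg_cst.
rewrite sub0r; apply: cvg_trans; apply: near_eq_cvg; near=> n.
have n0 : 0 < n%:R :> R by rewrite ltr0n; near: n; exact: nbhs_infty_gt.
rewrite -Rintegral_mkcondr (_ : _ `&` _ = `[0, n%:R]%classic); last first.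
  apply/seteqP; split => t /=; rewrite !in_itv/= andbT.
    by move=> [/andP[_ ->] ->].
  by move=> /andP[t0 ->]; rewrite t0 andbT (le_trans _ t0)// oppr_le0.
have := @continuous_FTC2 R f F 0 n%:R n0.
rewrite /Rintegral => ->//.
- exact: continuous_subspaceT.
- have cF : continuous F.
    by move=> x; apply/differentiable_continuous/derivable1_diffP.
  split => [x _||].
  + by [].
  + exact/cvg_at_right_filter/cF.
  + exact/cvg_at_left_filter/cF.
- by move=> x _; rewrite derive1E derive_val.
Unshelve. all: by end_near. Qed.

Lemma integrable_gweight_bounded j a (G : R -> R) y : 0 < a ->
  continuous G -> (forall x, `|G x| <= 1) ->
  mu.-integrable [set: R] (EFin \o (fun t => gweight j a t * G (y * t))).
Proof.
move=> a0 cG G1; apply: le_integrable (integrable_gweight j a0) => //.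
  apply/measurable_EFinP; apply: measurable_funM; first exact: measurable_gweight.
  apply: measurableT_comp; first exact: continuous_measurable_fun.
  exact: measurable_funM.
by move=> t _ /=; rewrite lee_fin normrM ler_piMr.
Qed.

(** Integration of the derivative of [t^j exp(- a t) G(y t)] over the half line. The triple
    [(G, G', c)] will be [(cos, sin, -1)] or [(sin, cos, 1)]. The term [0 ^+ j * G 0] is the
    boundary value at [0], present only for [j = 0], where the factor [j%:R] in turn removes the
    term in [j.-1]. *)
Lemma gweight_by_parts j a y (G G' : R -> R) (c : R) : 0 < a ->
  (forall t : R, is_derive t 1 G (c * G' t)) ->
  continuous G -> continuous G' ->
  (forall x, `|G x| <= 1) -> (forall x, `|G' x| <= 1) ->
  a * \int[mu]_t (gweight j a t * G (y * t)) - c * y * \int[mu]_t (gweight j a t * G' (y * t))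
   = j%:R * \int[mu]_t (gweight j.-1 a t * G (y * t)) + 0 ^+ j * G 0.
Proof.
move=> a0 dG cG cG' G1 G'1.
pose F t := t ^+ j * expR (- (a * t)) * G (y * t).
pose f t := (j%:R * t ^+ j.-1 * expR (- (a * t)) - a * (t ^+ j * expR (- (a * t)))) * G (y * t)
  + t ^+ j * expR (- (a * t)) * (c * y * G' (y * t)).
have dF (t : R) : is_derive t 1 F (f t).
  have dE : is_derive t 1 (fun t => expR (- (a * t))) (expR (- (a * t)) * (- a)).
    apply: (@is_derive1_comp _ expR (fun t => - (a * t))).
    by apply: is_derive_eq; rewrite /GRing.scale/= mulr1.
  have dGy : is_derive t 1 (fun t => G (y * t)) (c * G' (y * t) * y).
    apply: (@is_derive1_comp _ G (fun t => y * t)).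
    by apply: is_derive_eq; rewrite /GRing.scale/= mulr1.
  have dX : is_derive t 1 (fun t => t ^+ j) (j%:R * t ^+ j.-1).
    apply: DeriveDef; first exact: exprn_derivable.
    by rewrite exp_derive /GRing.scale/= mulr1.
  have -> : F = (fun t => t ^+ j) * (fun t => expR (- (a * t))) * (fun t => G (y * t)) by [].
  apply: is_derive_eq; rewrite /f /GRing.scale/=.
  by rewrite !fctE; ring.
have cf : continuous f.
  have cE : continuous (fun t : R => expR (- (a * t))).
    move=> t; apply: (@cvg_comp _ _ _ _ expR); last exact: continuous_expR.
    by apply: cvgN; apply: cvgM; [exact: cvg_cst|exact: cvg_id].
  have cy (K : R -> R) : continuous K -> continuous (fun t => K (y * t)).
    move=> cK t; apply: (@cvg_comp _ _ _ _ K); last exact: cK.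
    by apply: cvgM; [exact: cvg_cst|exact: cvg_id].
  move=> t; apply: cvgD; apply: cvgM.
  - apply: cvgB; apply: cvgM; last 1 first.
    + by apply: cvgM; [exact: exprn_continuous|exact: cE].
    + by apply: cvgM; [exact: cvg_cst|exact: exprn_continuous].
    + exact: cE.
    + exact: cvg_cst.
  - exact: cy.
  - by apply: cvgM; [exact: exprn_continuous|exact: cE].
  - by apply: cvgM; [exact: cvg_cst|exact: cy].
have I1 := integrable_gweight_bounded j y a0 cG G1.
have I2 := integrable_gweight_bounded j y a0 cG' G'1.
have I3 := integrable_gweight_bounded j.-1 y a0 cG G1.
have fE : f \_ `[0%R, +oo[ = fun t => j%:R * (gweight j.-1 a t * G (y * t))
    - a * (gweight j a t * G (y * t)) + c * y * (gweight j a t * G' (y * t)).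
  apply/funext => t; rewrite /gweight !patchE; case: ifPn => _.
    by rewrite /f; ring.
  by transitivity (0 : R); [|rewrite /point/=; ring].
have I1' : mu.-integrable [set: R] (EFin \o (fun t => a * (gweight j a t * G (y * t)))).
  exact: (integrableZl measurableT a I1).
have I2' : mu.-integrable [set: R] (EFin \o (fun t => c * y * (gweight j a t * G' (y * t)))).
  exact: (integrableZl measurableT (c * y) I2).
have I3' : mu.-integrable [set: R] (EFin \o (fun t => j%:R * (gweight j.-1 a t * G (y * t)))).
  exact: (integrableZl measurableT j%:R I3).
have I13 : mu.-integrable [set: R] (EFin \o (fun t => j%:R * (gweight j.-1 a t * G (y * t))
    - a * (gweight j a t * G (y * t)))).
  exact: (integrableB measurableT I3' I1').
have := @Rintegral_derive0y F f dF cf.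
rewrite fE => /(_ (integrableD measurableT I13 I2')).
rewrite RintegralD// RintegralB// !RintegralZl//.
have cF : F n%:R @[n --> \oo] --> (0 : R).
  have cg := cvg_gweight j a0.
  apply: (@squeeze_cvgr _ _ _ _ (fun n => - gweight j a n%:R) (fun n => gweight j a n%:R)).
  - near=> n; rewrite -ler_norml /F -gweightE//.
    by rewrite normrM ger0_norm ?gweight_ge0// ler_piMr// gweight_ge0.
  - by rewrite -oppr0; exact: cvgN.
  - exact: cg.
move=> /(_ cF); rewrite /F !mulr0 oppr0 expR0 mulr1 => h.
by move: (0 ^+ j * G 0) h => z h; lra.
Unshelve. all: by end_near. Qed.

(** The integrations by parts for cosine and sine combine into [(a - i y) I_n = n I_(n-1) + 0^n] for
    the complex integrals [I_n]; induction solves this recurrence. *)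
Lemma gweight_transform j a y : 0 < a ->
  (\int[mu]_t (gweight j a t * cos (y * t))) +i*
  (\int[mu]_t (gweight j a t * sin (y * t))) =
  (j`!%:R)%:C / (a%:C - (0 +i* y)) ^+ j.+1.
Proof.
move=> a0.
have dcos (t : R) : is_derive t 1 (@cos R) (-1 * sin t).
  by apply: is_derive_eq; rewrite mulN1r.
have dsin (t : R) : is_derive t 1 (@sin R) (1 * cos t).
  by apply: is_derive_eq; rewrite mul1r.
have hC n := gweight_by_parts n y a0 dcos (@continuous_cos R) (@continuous_sin R)
  (@normr_cos R) (@normr_sin R).
have hS n := gweight_by_parts n y a0 dsin (@continuous_sin R) (@continuous_cos R)
  (@normr_sin R) (@normr_cos R).
pose C n := \int[mu]_t (gweight n a t * cos (y * t)).
pose S n := \int[mu]_t (gweight n a t * sin (y * t)).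
have {}hC n : a * C n + y * S n = n%:R * C n.-1 + 0 ^+ n.
  by have := hC n; rewrite -/(C _) -/(S _) cos0 mulr1 mulN1r mulNr opprK.
have {}hS n : a * S n - y * C n = n%:R * S n.-1.
  by have := hS n; rewrite -/(C _) -/(S _) sin0 mulr0 addr0 mul1r.
rewrite -/(C j) -/(S j); set d := a%:C - _.
have d0 : d != 0.
  by rewrite eq_complex/= subr0 (gt_eqF a0).
have dCS n : d * (C n +i* S n) = (n%:R)%:C * (C n.-1 +i* S n.-1) + (0 ^+ n)%:C.
  apply/eqP; rewrite eq_complex/=; apply/andP; split; apply/eqP.
    by transitivity (a * C n + y * S n); [ring|rewrite hC; ring].
  by transitivity (a * S n - y * C n); [ring|rewrite hS; ring].
elim: j => [|j IH].
  have := dCS 0%N; rewrite expr0 mulr0n mul0r add0r => h.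
  by rewrite expr1 fact0 -h mulrAC mulfV// mul1r.
have := dCS j.+1; rewrite /= IH expr0n/= addr0 => h.
apply: (mulfI d0); rewrite h (exprS _ j.+1) factS natrM rmorphM/=.
by field; rewrite expf_neq0 ?d0.
Qed.

(** The Gamma integral is the transform of [gweight] at [a = 1], [y = 0]. *)
Lemma Gamma_nat k : (0 < k)%N -> Gamma (k%:R : R) = (k.-1)`!%:R.
Proof.
case: k => // k _; have := gweight_transform k 0 (@ltr01 R).
rewrite (_ : 1%:C - (0 +i* 0) = 1); last by apply/eqP; rewrite eq_complex/= !subr0 !eqxx.
rewrite expr1n divr1 => -[<- _].
transitivity (\int[mu]_(t in `]0%R, +oo[) gweight k 1 t).
  apply: eq_Rintegral => t; rewrite inE/= in_itv/= andbT => t0.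
  by rewrite gweightE ?ltW// mul1r -natr1 addrK powR_mulrn ?ltW.
rewrite Rintegral_itv_obnd_cbnd; last first.
  by apply: integrableS (integrable_gweight k (@ltr01 R)).
rewrite Rintegral_mkcond; apply: eq_Rintegral => t _.
rewrite mul0r cos0 mulr1 patchE; case: ifPn => // t0.
rewrite gweight_lt0// ltNge; apply/negP => t0'; move/negP: t0; apply.
by rewrite inE/= in_itv/= t0'.
Qed.

End GammaWeight.

(** * Gaussian smoothing of the measure *)

Section SmoothedDifference.
Variable R : realType.
Local Notation mu := (@lebesgue_measure R).

Lemma segment_bounded (f : R -> R) (e : R) : continuous f ->
  exists2 M : R, 0 <= M & forall y, `|y| <= e -> `|f y| <= M.
Proof.
move=> cf; have [e0|e0] := ltP e 0.
  exists 0 => // y ye; have := le_lt_trans ye e0.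
  by rewrite ltNge normr_ge0.
have ee : - e <= e by rewrite ge0_cp.
have [|c _ cP] := @EVT_max R (fun y => `|f y|) _ _ ee.
  apply: continuous_subspaceT => y.
  apply: (@cvg_comp _ _ _ _ Num.norm); last exact: norm_continuous.
  exact: cf.
by exists `|f c| => // y ye; apply: cP; rewrite in_itv/= -ler_norml.
Qed.

(** * Bounds for the extension on a closed substrip *)

Section bound.
Variables (h : R[i] -> R[i]) (alpha beta : R) (D : set R[i]).
Hypothesis subD : [set z | complex.Re z < beta] `<=` D.
Hypothesis h_analytic : analytic_on [set z | complex.Re z < beta] h.
Hypothesis h_bounded : exists eps0 : R, 0 < eps0 /\
  exists M : R, forall z : R[i], D z -> 0 <= complex.Re z <= beta ->
    eps0%:C < `|z - alpha%:C| -> `|h z| <= M%:C.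

Lemma vertical_line_bounded (x e : R) : x < beta ->
  exists2 M : R, 0 <= M & forall y, `|y| <= e -> `|h (x +i* y)| <= M%:C.
Proof.
move=> xb.
have cont (th : R[i]) : continuous (fun y => complex.Re (th * h (x +i* y))).
  move=> y.
  have dh : derivable ((fun z => th * h z) : R[i]^o -> R[i]^o) (x +i* y) 1.
    by apply: derivableM; [exact: derivable_cst|exact: h_analytic].
  by have [] := closed_form_continuous (derivable_closed_form dh).
have [M1 M10 h1] := segment_bounded e (cont 1).
have [M2 M20 h2] := segment_bounded e (cont (0 -i* 1)).
exists (M1 + M2); first exact: addr_ge0.
move=> y ye; apply: (le_trans (normc_le_add _)); rewrite lecR lerD//.
  by have := h1 y ye; rewrite mul1r.
have := h2 y ye; rewrite ReM/= mul0r mulN1r opprK add0r//.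
Qed.

(** The hypothesis bounds [h] wherever [|y|] exceeds the radius of the excluded disc. What remains
    of the lines [x = 0] and [x = c] is two compact segments, on which [h] is continuous. [T] is the
    radius plus one, so that [T <= |y|] excludes these heights. *)
Lemma strip_bounded (c : R) : 0 <= c < beta ->
  exists M T : R, 0 <= M /\ forall x y : R, 0 <= x <= c ->
    [|| x == 0, x == c | T <= `|y|] -> `|h (x +i* y)| <= M%:C.
Proof.
move=> /andP[c0 cb]; have [e [e0 [M hM]]] := h_bounded.
have [M1 M10 h1] := vertical_line_bounded e (le_lt_trans c0 cb).
have [M2 M20 h2] := vertical_line_bounded e cb.
have far x y : 0 <= x <= c -> e < `|y| -> `|h (x +i* y)| <= M%:C.
  move=> /andP[x0 xc] ey; have xb := le_lt_trans xc cb; apply: hM.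
  - exact: subD.
  - by rewrite /= x0 ltW.
  - apply: lt_le_trans (normc_ge_Im _).
    by rewrite ltcR ImD/= oppr0 addr0.
exists (`|M| + M1 + M2), (e + 1); split; first by rewrite !addr_ge0.
have hMM : M <= `|M| + M1 + M2 by rewrite (le_trans (ler_norm M))// -addrA lerDl addr_ge0.
move=> x y xc; have [ey _|ye] := ltP e `|y|.
  by rewrite (le_trans (far _ _ xc ey))// lecR.
move=> /or3P[/eqP ->|/eqP ->|yT].
- rewrite (le_trans (h1 _ ye))// lecR.
  by have := normr_ge0 M; lra.
- rewrite (le_trans (h2 _ ye))// lecR.
  by have := normr_ge0 M; lra.
- by have := le_trans yT ye; rewrite gerDl ler10.
Qed.

End bound.

(** * Trigonometric transforms of a weighted measure *)

Section transform.
Variables (m : {sigma_finite_measure set (measurableTypeR R) -> \bar R}) (w : R -> R).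
Hypothesis intw : m.-integrable [set: R] (EFin \o w).

Lemma integrable_bounded_weight (F : R -> R) (y x : R) :
  continuous F -> (forall x, `|F x| <= 1) ->
  m.-integrable [set: R] (EFin \o (fun t => w t * F (y * (t - x)))).
Proof.
move=> cF F1.
have mw : measurable_fun [set: measurableTypeR R] w.
  by apply/measurable_EFinP; exact: measurable_int intw.
have mF : measurable_fun [set: measurableTypeR R] F by exact: continuous_measurable_fun.
apply: le_integrable intw => //.
  apply/measurable_EFinP; apply: measurable_funM => //.
  apply: (measurableT_comp mF).
  by apply: measurable_funM => //; apply: measurable_funB.
by move=> t _ /=; rewrite lee_fin normrM ler_piMr.
Qed.

Definition Ctrans (x y : R) := \int[m]_t (w t * cos (y * (t - x))).
Definition Strans (x y : R) := \int[m]_t (w t * sin (y * (t - x))).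

(** Translation by [x] multiplies the transform by [exp(- i x y)], the value of [exp(- x z)] at
    [z = i y]. *)
Lemma trans_shift (x y : R) : Ctrans x y +i* Strans x y =
  (Ctrans 0 y +i* Strans 0 y) * (cos (x * y) -i* sin (x * y)).
Proof.
have ic x := integrable_bounded_weight y x (@continuous_cos R) (@normr_cos R).
have is_ x := integrable_bounded_weight y x (@continuous_sin R) (@normr_sin R).
rewrite /Ctrans /Strans; apply/eqP; rewrite eq_complex/=; apply/andP; split; apply/eqP.
- rewrite mulrN opprK -!RintegralZr// -RintegralD//.
  + apply: eq_Rintegral => t _; rewrite subr0 mulrBr cosB (mulrC y x); ring.
  + exact: (integrableZr measurableT _ (ic 0)).
  + exact: (integrableZr measurableT _ (is_ 0)).
- rewrite mulrN addrC -!RintegralZr// -RintegralB//.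
  + apply: eq_Rintegral => t _; rewrite subr0 mulrBr sinB (mulrC y x); ring.
  + exact: (integrableZr measurableT _ (is_ 0)).
  + exact: (integrableZr measurableT _ (ic 0)).
Qed.

Definition smooth s x := \int[m]_t (w t * normal_fun x s t).

(** Fubini moves the Gaussian integral inside, where [fourier_gauss] evaluates it: integrating the
    transform against [gauss s] returns the smoothed density up to a constant. *)
Lemma Rintegral_trans s x : s != 0 ->
  [/\ mu.-integrable [set: R] (EFin \o (fun y => Ctrans x y * gauss s y)),
   mu.-integrable [set: R] (EFin \o (fun y => Strans x y * gauss s y)),
   \int[mu]_y (Ctrans x y * gauss s y) = (normal_peak s^-1)^-1 * smooth s x &
   \int[mu]_y (Strans x y * gauss s y) = 0].
Proof.
move=> s0.
have [iC CE] := fubini_gauss x s0 intw (@continuous_cos R) (@normr_cos R).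
have [iS SE] := fubini_gauss x s0 intw (@continuous_sin R) (@normr_sin R).
split => //.
- rewrite [LHS]CE /smooth -RintegralZl//.
    apply: eq_Rintegral => t _; have [-> _] := fourier_gauss (t - x) s0.
    by rewrite mulrCA /normal_fun mulNr.
  apply: le_integrable intw => //.
    apply/measurable_EFinP; apply: measurable_funM => //.
      by apply/measurable_EFinP; exact: measurable_int intw.
    exact: measurable_normal_fun.
  move=> t _ /=; rewrite lee_fin normrM ler_piMr// ger0_norm ?normal_fun_ge0//.
  rewrite /normal_fun -[leRHS]expR0 ler_expR mulNr oppr_le0 divr_ge0 ?sqr_ge0//.
  by rewrite mulrn_wge0// sqr_ge0.
- rewrite [LHS]SE; transitivity (\int[m]_t (0 : R)).
    apply: eq_Rintegral => t _; have [_ ->] := fourier_gauss (t - x) s0.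
    by rewrite mulr0.
  by rewrite Rintegral_cst// mul0r.
Qed.

End transform.

(** * Comparison of the two smoothed densities *)

Section difference.
Variables (nu : {finite_measure set (measurableTypeR R) -> \bar R}).
Variables (k : nat) (b : R[i]) (alpha beta : R) (D : set R[i]) (h : R[i] -> R[i]).
Hypotheses (k_gt0 : (0 < k)%N) (alpha_gt0 : 0 < alpha).
Hypothesis subD : [set z | complex.Re z < beta] `<=` D.
Hypothesis h_analytic : analytic_on [set z | complex.Re z < beta] h.
Hypothesis h_extends : forall z : R[i], complex.Re z <= 0 ->
  h z = mgf nu z - b / (alpha%:C - z) ^+ k.
Hypothesis h_bounded : exists eps0 : R, 0 < eps0 /\
  exists M : R, forall z : R[i], D z -> 0 <= complex.Re z <= beta ->
    eps0%:C < `|z - alpha%:C| -> `|h z| <= M%:C.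

Let w : R -> R := \1_(`[0%R, +oo[).
Let p : R -> R := gweight k.-1 alpha.

Lemma integrable_indic_half : nu.-integrable [set: R] (EFin \o w).
Proof.
exact: integrable_indic.
Qed.

Lemma mgf_imaginary (y : R) :
  mgf nu (0 +i* y) = Ctrans nu w 0 y +i* Strans nu w 0 y.
Proof.
rewrite /mgf /Cintegral /Ctrans /Strans Rintegral_mkcond [in X in _ +i* X = _]Rintegral_mkcond.
congr (_ +i* _); apply: eq_Rintegral => t _; rewrite patchE /w indicE subr0.
- case: ifPn => _; rewrite ?mul0r// mul1r /cexp/= !mulr0 mul0r add0r.
  by rewrite oppr0 expR0 mul1r mul0r subr0 add0r.
- case: ifPn => _; rewrite ?mul0r// mul1r /cexp/= !mulr0 mul0r add0r.
  by rewrite oppr0 expR0 mul1r mul0r addr0 add0r.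
Qed.

Lemma h_imaginary (y : R) : h (0 +i* y) =
  (Ctrans nu w 0 y +i* Strans nu w 0 y) -
  b / ((k.-1)`!%:R)%:C * (Ctrans mu p 0 y +i* Strans mu p 0 y).
Proof.
rewrite h_extends/= ?lexx// mgf_imaginary; congr (_ - _).
have -> : Ctrans mu p 0 y +i* Strans mu p 0 y = ((k.-1)`!%:R)%:C / (alpha%:C - (0 +i* y)) ^+ k.
  rewrite -[in RHS](prednK k_gt0) -gweight_transform//.
  rewrite /Ctrans /Strans.
  by congr (_ +i* _); apply: eq_Rintegral => t _; rewrite subr0.
rewrite mulrA divfK// eq_complex/= eqxx andbT pnatr_eq0.
by rewrite -lt0n fact_gt0.
Qed.

(** [contour_shift] sees real parts only, whence the factor [th]: [th = 1] compares the real parts,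
    and [th = i] isolates the imaginary part of [b]. The constant [K] depends on neither [th] nor
    [x]. *)
Lemma smooth_difference (c s : R) : s != 0 -> 0 <= c < beta ->
  exists K : R, forall (th : R[i]) (x : R), `|th| <= 1 ->
    `|complex.Re th * smooth nu w s x
      - complex.Re (th * (b / ((k.-1)`!%:R)%:C)) * smooth mu p s x|
    <= K * expR (- (c * x)).
Proof.
move=> s0 c0b; have /andP[c0 cb] := c0b.
have [M [T [M0 hM]]] := strip_bounded subD h_analytic h_bounded c0b.
pose a := s ^+ 2 / 2.
have a0 : 0 <= a by rewrite divr_ge0// sqr_ge0.
pose G := (normal_peak s^-1)^-1.
have G0 : 0 < G by rewrite invr_gt0 normal_peak_gt0// invr_eq0.
exists (M * expR (a * c ^+ 2)) => th x th1.
pose b' := b / ((k.-1)`!%:R)%:C; rewrite -/b'.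
pose H z := th * (h z * cgauss a x z).
have dH (z1 z2 : R) : 0 <= z1 <= c -> derivable (H : R[i]^o -> R[i]^o) (z1 +i* z2) 1.
  move=> /andP[_ z1c]; apply: derivableM; first exact: derivable_cst.
  apply: derivableM; last exact: derivable_cgauss.
  by apply: h_analytic => /=; exact: le_lt_trans cb.
(* A bound on the strip that serves only to justify the shift and loses [exp(|x| c)]. The decay
   [exp(- c x)] comes from [Hc], on the line [Re z = c] alone. *)
pose Dx y := M * expR (a * c ^+ 2 + `|x| * c) * gauss s y.
have HD z1 z2 : 0 <= z1 <= c -> [|| z1 == 0, z1 == c | T <= `|z2|] ->
    `|H (z1 +i* z2)| <= (Dx z2)%:C.
  move=> z1c hz; have /andP[z10 z1c'] := z1c.
  rewrite /H (normrM th) (normrM (h _)) -[leRHS]mul1r; apply: ler_pM => //.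
  rewrite /Dx -(mulrA M) rmorphM/=; apply: ler_pM => //; first exact: hM.
  rewrite normc_cgauss lecR /gauss -expRD ler_expR mulrBr.
  have -> : a * z2 ^+ 2 = s ^+ 2 * z2 ^+ 2 / 2 by rewrite /a; field.
  have : a * z1 ^+ 2 <= a * c ^+ 2 by rewrite ler_wpM2l// lerXn2r// nnegrE.
  have : - (x * z1) <= `|x| * c.
    by rewrite -mulNr (le_trans (ler_norm _))// normrM normrN ler_wpM2l// ger0_norm.
  lra.
have shift := contour_shift c0 dH _ _ _ HD.
have {}shift : \int[mu]_y complex.Re (H (0 +i* y)) = \int[mu]_y complex.Re (H (c +i* y)).
  apply: shift.
  - exact: (integrableZl measurableT _ (integrable_gauss s0)).
  - by move=> y; rewrite /Dx gaussN.
  - rewrite /Dx -(mulr0 (M * expR (a * c ^+ 2 + `|x| * c))).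
    by apply: cvgM; [exact: cvg_cst|exact: cvg_gauss].
have nuint := integrable_indic_half.
have pint := integrable_gweight k.-1 alpha_gt0.
have [inC inS nC nS] := Rintegral_trans nuint x s0.
have [ipC ipS pC pS] := Rintegral_trans pint x s0.
have H0 y : complex.Re (H (0 +i* y)) =
    complex.Re th * (Ctrans nu w x y * gauss s y)
    - complex.Im th * (Strans nu w x y * gauss s y)
    - complex.Re (th * b') * (Ctrans mu p x y * gauss s y)
    + complex.Im (th * b') * (Strans mu p x y * gauss s y).
  have -> : H (0 +i* y) = (th * (Ctrans nu w x y +i* Strans nu w x y)
      - th * b' * (Ctrans mu p x y +i* Strans mu p x y)) * (gauss s y)%:C.
    rewrite (trans_shift nuint) (trans_shift pint) /H h_imaginary -/b' cgaussE.
    have -> : expR (a * (0 ^+ 2 - y ^+ 2) - x * 0) = gauss s y.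
      by congr expR; rewrite /a; field.
    have -> : 2 * a * 0 * y - x * y = - (x * y) by ring.
    by rewrite cosN sinN; ring.
  by rewrite ReM/= ReD ReN !ReM/=; ring.
(* The sine transforms integrate to zero against the Gaussian, so only the smoothed densities
   survive. *)
have E0 : \int[mu]_y complex.Re (H (0 +i* y)) =
    G * (complex.Re th * smooth nu w s x - complex.Re (th * b') * smooth mu p s x).
  under eq_Rintegral do rewrite H0.
  have i1 := integrableZl measurableT (complex.Re th) inC.
  have i2 := integrableZl measurableT (complex.Im th) inS.
  have i3 := integrableZl measurableT (complex.Re (th * b')) ipC.
  have i4 := integrableZl measurableT (complex.Im (th * b')) ipS.
  have i12 := integrableB measurableT i1 i2.
  have i123 := integrableB measurableT i12 i3.
  rewrite RintegralD// RintegralB// RintegralB// !RintegralZl// nC nS pC pS.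
  by rewrite /G; ring.
rewrite -(ler_pM2l G0) -{1}(ger0_norm (ltW G0)) -normrM -E0 shift.
have Hc y : `|complex.Re (H (c +i* y))| <= M * expR (a * c ^+ 2) * expR (- (c * x)) * gauss s y.
  rewrite -lecR; apply: (le_trans (normc_ge_Re _)).
  rewrite /H (normrM th) (normrM (h _)) -[leRHS]mul1r; apply: ler_pM => //.
  rewrite -!(mulrA M) rmorphM/=; apply: ler_pM => //.
    by apply: hM; rewrite ?eqxx ?orbT// c0 lexx.
  rewrite normc_cgauss lecR /gauss -!expRD ler_expR.
  by rewrite le_eqVlt; apply/orP; left; apply/eqP; rewrite /a; field.
have iHc : mu.-integrable [set: R] (EFin \o (fun y => complex.Re (H (c +i* y)))).
  apply: le_integrable (integrableZl measurableT (M * expR (a * c ^+ 2) * expR (- (c * x))) (integrable_gauss s0)) => //.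
    apply/measurable_EFinP; apply: continuous_measurable_fun => y.
    have ccc : 0 <= c <= c by rewrite c0 lexx.
    by have [] := closed_form_continuous (derivable_closed_form (dH c y ccc)).
  move=> y _ /=; rewrite lee_fin (le_trans (Hc y))// ler_norm//.
apply: (le_trans (le_normr_Rintegral _ iHc)) => //.
apply: le_trans (_ : \int[mu]_y (M * expR (a * c ^+ 2) * expR (- (c * x)) * gauss s y) <= _).
  apply: le_Rintegral => //.
  - exact: (integrable_abse iHc).
  - exact: (integrableZl measurableT _ (integrable_gauss s0)).
rewrite RintegralZl//; last exact: integrable_gauss.
by rewrite Rintegral_gauss// mulrC.
Qed.

End difference.
End SmoothedDifference.

(** * Sandwiching tails between smoothed tails *)

Section Psi.
Variable R : realType.
Local Notation mu := (@lebesgue_measure R).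
Implicit Types (s t x X : R).

Lemma normal_pdf_expE t s x : s != 0 ->
  normal_pdf t s x = normal_peak s * expR (- ((x - t) ^+ 2 / (s ^+ 2 *+ 2))).
Proof. by move=> s0; rewrite normal_pdfE//= /normal_fun mulNr. Qed.

Lemma normal_pdf_sym t s x : s != 0 -> normal_pdf t s x = normal_pdf x s t.
Proof.
by move=> s0; rewrite !normal_pdf_expE// -(sqrrN (x - t)) opprB.
Qed.

Lemma normal_peak_scale s : 0 < s -> normal_peak s = s^-1 * normal_peak (1 : R).
Proof.
move=> s0; rewrite /normal_peak -invfM; congr (_^-1).
rewrite expr1n mul1r -(mulrnAr (s ^+ 2)) sqrtrM ?sqr_ge0//.
by rewrite sqrtr_sqr gtr0_norm.
Qed.

(** Ratio of the normal densities of deviations [s] and [1] at distance [eta] from their centre; for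
    [s < 1] it decreases with the distance. *)
Definition domination_factor s (eta : R) : R :=
  s^-1 * expR (- (eta ^+ 2 / 2 * (s ^- 2 - 1))).

Lemma normal_pdf_dominated s (eta : R) t x : 0 < s < 1 -> 0 <= eta <= `|x - t| ->
  normal_pdf t s x <= domination_factor s eta * normal_pdf t 1 x.
Proof.
move=> /andP[s0 s1] /andP[eta0 eta_le].
rewrite !normal_pdf_expE ?gt_eqF// normal_peak_scale// /domination_factor.
rewrite -(mulrA s^-1 (normal_peak 1)) -(mulrA s^-1 (expR _)).
apply: ler_wpM2l; first by rewrite invr_ge0 ltW.
rewrite [leRHS]mulrCA; apply: ler_wpM2l; first exact: normal_peak_ge0.
rewrite -expRD ler_expR.
have s2 : 0 <= s ^- 2 - 1.
  by rewrite subr_ge0 invf_ge1 ?exprn_gt0// exprn_ile1// ltW.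
have : eta ^+ 2 / 2 * (s ^- 2 - 1) <= (x - t) ^+ 2 / 2 * (s ^- 2 - 1).
  rewrite ler_wpM2r// ler_wpM2r// -(real_normK (num_real (x - t))).
  by rewrite lerXn2r// nnegrE.
have -> : (x - t) ^+ 2 / (s ^+ 2 *+ 2) = (x - t) ^+ 2 / 2 * (s ^- 2 - 1) + (x - t) ^+ 2 / 2.
  by field; rewrite gt_eqF.
by rewrite expr1n; lra.
Qed.

Lemma domination_factor_small (eta e : R) : 0 < eta -> 0 < e ->
  exists2 s : R, 0 < s < 1 & 0 <= domination_factor s eta <= e.
Proof.
move=> eta0 e0; pose c := eta ^+ 2 / 2.
have c0 : 0 < c by rewrite divr_gt0// exprn_gt0.
(* The deviation is [1 / y]. From [y >= 2] follows [y^2 - 1 >= y^2 / 2], so the factor is at most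
   [y / (c y^2 / 2) = 2 / (c y)], and [y >= 2 / (c e)] makes this at most [e]. *)
pose y := 2 + 2 / (c * e).
have ce0 : 0 < c * e by rewrite mulr_gt0.
have y2 : 2 < y by rewrite ltrDl divr_gt0.
have y0 : 0 < y by lra.
exists y^-1.
  by rewrite invr_gt0 y0 invf_lt1//; lra.
rewrite /domination_factor invrK -exprVn invrK -/c.
apply/andP; split; first by rewrite mulr_ge0 ?expR_ge0// ltW.
have y21 : y ^+ 2 / 2 <= y ^+ 2 - 1.
  have : 2 ^+ 2 <= y ^+ 2 by rewrite lerXn2r ?nnegrE// ltW.
  by lra.
have cy : c * (y ^+ 2 / 2) <= expR (c * (y ^+ 2 - 1)).
  apply: le_trans (_ : c * (y ^+ 2 - 1) <= _); first by rewrite ler_wpM2l// ltW.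
  by rewrite (le_trans _ (expR_ge1Dx _))// lerDr.
rewrite expRN; apply: le_trans (_ : y * (c * (y ^+ 2 / 2))^-1 <= _).
  apply: ler_wpM2l; first exact: ltW.
  by rewrite lef_pV2 ?posrE ?expR_gt0// mulr_gt0// divr_gt0// exprn_gt0.
have -> : y * (c * (y ^+ 2 / 2))^-1 = 2 / (c * y) by field; rewrite !gt_eqF.
rewrite ler_pdivrMr ?mulr_gt0// mulrA -ler_pdivrMl; last by rewrite mulrC.
by rewrite (mulrC e) (mulrC _^-1) lerDr.
Qed.

(** Probability that a normal variable of mean [t] and deviation [s] is at least [X]: a smoothed
    indicator of [t > X]. *)
Definition Psi s X t : R := \int[mu]_(x in `[X, +oo[) normal_pdf t s x.

Lemma integrable_normal_pdfS t s (A : set (measurableTypeR R)) : measurable A ->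
  mu.-integrable A (EFin \o normal_pdf t s).
Proof. by move=> mA; apply: integrableS (integrable_normal_pdf t s). Qed.

Lemma Rintegral_normal_pdf t s : \int[mu]_x normal_pdf t s x = 1.
Proof. by rewrite /Rintegral integral_normal_pdf. Qed.

Lemma Psi_compl s X t :
  Psi s X t = 1 - \int[mu]_(x in `]-oo, X[) normal_pdf t s x.
Proof.
have disj : [disjoint `]-oo, X[%classic & `[X, +oo[%classic].
  apply/disj_setPS => y [/=]; rewrite !in_itv/= andbT => yX.
  by rewrite leNgt yX.
have U : `]-oo, X[%classic `|` `[X, +oo[%classic = [set: R].
  apply/seteqP; split => // y _ /=; rewrite !in_itv/= andbT.
  by have [?|?] := ltP y X; [left|right].
rewrite -(Rintegral_normal_pdf t s) -U Rintegral_setU//; last first.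
  by rewrite U; exact: integrable_normal_pdfS.
by rewrite addrC addKr.
Qed.

Lemma Psi_ge0 s X t : 0 <= Psi s X t.
Proof. by apply: Rintegral_ge0 => x _; exact: normal_pdf_ge0. Qed.

Lemma Psi_le1 s X t : Psi s X t <= 1.
Proof.
rewrite Psi_compl lerBlDr lerDl; apply: Rintegral_ge0 => x _.
exact: normal_pdf_ge0.
Qed.

(** If [t > X + eta], the mass below [X] lies at distance at least [eta] from the centre and is
    therefore dominated; if [t <= X - eta], so is the mass above [X]. The upper bound keeps
    [Psi 1 X t] instead of [1], so that integration in [t] produces a smoothed tail and not the
    total mass. *)
Lemma Psi_sandwich s (eta : R) X t : 0 < s < 1 -> 0 <= eta ->
  (1 - domination_factor s eta) * \1_(`]X + eta, +oo[) t <= Psi s X t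
  <= \1_(`]X - eta, +oo[) t + domination_factor s eta * Psi 1 X t.
Proof.
move=> s01 eta0; set d := domination_factor s eta.
have d0 : 0 <= d.
  by have /andP[s0 _] := s01; rewrite mulr_ge0 ?expR_ge0// invr_ge0 ltW.
have dom (A : set (measurableTypeR R)) : measurable A -> (forall x, A x -> eta <= `|x - t|) ->
    \int[mu]_(x in A) normal_pdf t s x <= d * \int[mu]_(x in A) normal_pdf t 1 x.
  move=> mA hA; rewrite -RintegralZl//; last exact: integrable_normal_pdfS.
  apply: le_Rintegral => //.
  - exact: integrable_normal_pdfS.
  - have i1 := integrable_normal_pdfS t 1 mA.
    exact: (integrableZl mA d i1).
  - by move=> x Ax; apply: normal_pdf_dominated => //; rewrite eta0 hA.
apply/andP; split; rewrite indicE.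
- have [|_] := boolP (t \in `]X + eta, +oo[%classic); last by rewrite mulr0 Psi_ge0.
  rewrite inE/= in_itv/= andbT => tX; rewrite mulr1 Psi_compl lerB//.
  apply: (le_trans (dom _ _ _)) => //.
    move=> x; rewrite /= in_itv/= => xX.
    by rewrite ler_normr; apply/orP; right; lra.
  rewrite ler_piMr//.
  have := Psi_compl 1 X t; have := Psi_ge0 1 X t; lra.
- have [_|] := boolP (t \in `]X - eta, +oo[%classic).
    by rewrite (le_trans (Psi_le1 _ _ _))// lerDl mulr_ge0 ?Psi_ge0.
  move=> /negP; rewrite inE/= in_itv/= andbT => /negP; rewrite -leNgt => tX.
  rewrite add0r; apply: dom => // x; rewrite /= in_itv/= andbT => xX.
  by rewrite ler_normr; apply/orP; left; lra.
Qed.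

End Psi.

(** * Smoothed tails of a weighted measure *)

Section Average.
Variable R : realType.
Local Notation mu := (@lebesgue_measure R).

Lemma integral_expR_tail (c X : R) : 0 < c ->
  (\int[mu]_(x in `[X, +oo[) (expR (- (c * x)))%:E = (expR (- (c * X)) / c)%:E)%E.
Proof.
move=> c0; pose F x := - (expR (- (c * x)) / c).
have dF (x : R) : is_derive x 1 F (expR (- (c * x))).
  have dE : is_derive x 1 (fun t => expR (- (c * t))) (expR (- (c * x)) * (- c)).
    apply: (@is_derive1_comp _ expR (fun t => - (c * t))).
    by apply: is_derive_eq; rewrite /GRing.scale/= mulr1.
  have -> : F = cst (- c^-1) * (fun t => expR (- (c * t))).
    by apply/funext => t; rewrite /F fctE/= mulNr mulrC.
  by apply: is_derive_eq; rewrite /GRing.scale/=; field; rewrite gt_eqF.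
have cE : continuous (fun x : R => expR (- (c * x))).
  move=> x; apply: (@cvg_comp _ _ _ _ expR); last exact: continuous_expR.
  by apply: cvgN; apply: cvgM; [exact: cvg_cst|exact: cvg_id].
have cF : continuous F.
  by move=> x; apply/differentiable_continuous/derivable1_diffP.
rewrite (@ge0_continuous_FTC2y _ _ F X 0).
- by rewrite /F -EFinB sub0r opprK.
- by move=> x _; exact: expR_ge0.
- exact: continuous_subspaceT.
- rewrite -oppr0; apply: cvgN; rewrite -(mul0r c^-1); apply: cvgM; last exact: cvg_cst.
  apply: (@cvg_comp _ _ _ (fun x => c * x) (fun x => expR (- x)) _ (pinfty_nbhs R)).
    by apply: gt0_cvgMry.
  exact: cvgr_expR.
- by [].
- exact/cvg_at_right_filter/cF.
- by move=> x _; rewrite derive1E derive_val.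
Unshelve. all: by end_near. Qed.

Lemma integrable_expR_tail (c X : R) : 0 < c ->
  mu.-integrable `[X, +oo[ (EFin \o (fun x => expR (- (c * x)))).
Proof.
move=> c0; apply/integrableP; split.
  apply/measurable_EFinP; apply: measurable_funTS.
  by apply: measurableT_comp => //; apply: measurableT_comp => //; exact: measurable_funM.
under eq_integral do rewrite /= ger0_norm ?expR_ge0//.
by rewrite integral_expR_tail// ltry.
Qed.

Lemma measurable_normal_pdf2 (s : R) : s != 0 ->
  measurable_fun [set: measurableTypeR R * measurableTypeR R]
    (fun z => normal_pdf z.1 s z.2).
Proof.
move=> s0; under eq_fun do rewrite normal_pdf_expE//.
apply: measurable_funM => //; apply: measurableT_comp => //.
apply: measurableT_comp => //; apply: measurable_funM => //.
apply: measurable_funX.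
by apply: measurable_funB.
Qed.

Lemma integrable_normal_pdf_indic (s X t : R) :
  mu.-integrable [set: R] (EFin \o (fun x => normal_pdf t s x * \1_(`[X, +oo[) x)).
Proof.
apply: le_integrable (integrable_normal_pdf t s) => //.
  by apply/measurable_EFinP; apply: measurable_funM => //; exact: measurable_normal_pdf.
move=> x _ /=; rewrite lee_fin normrM ler_piMr// indicE.
by case: (_ \in _); rewrite ?normr1 ?normr0.
Qed.

Lemma PsiE (s X t : R) :
  Psi s X t = \int[mu]_x (normal_pdf t s x * \1_(`[X, +oo[) x).
Proof.
rewrite /Psi Rintegral_mkcond; apply: eq_Rintegral => x _.
by rewrite patchE indicE; case: ifPn => _; rewrite ?mulr1 ?mulr0.
Qed.

Lemma measurable_Psi (s X : R) : s != 0 ->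
  measurable_fun [set: measurableTypeR R] (Psi s X).
Proof.
move=> s0.
pose g (z : measurableTypeR R * measurableTypeR R) : \bar R :=
  (normal_pdf z.1 s z.2 * \1_(`[X, +oo[) z.2)%:E.
have mg : measurable_fun setT g.
  apply/measurable_EFinP; apply: measurable_funM.
    exact: measurable_normal_pdf2.
  by apply: measurableT_comp.
have g0 z : (0 <= g z)%E by rewrite lee_fin mulr_ge0 ?normal_pdf_ge0.
apply/measurable_EFinP.
apply: (eq_measurable_fun (fun t => \int[mu]_x g (t, x))%E).
  by move=> t _; rewrite /= PsiE fineK//; exact: integrable_fin_num (integrable_normal_pdf_indic s X t).
exact: (measurable_fun_fubini_tonelli_F g).
Qed.

Variables (m : {sigma_finite_measure set (measurableTypeR R) -> \bar R}) (w : R -> R).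
Hypotheses (w0 : forall t, 0 <= w t) (intw : m.-integrable [set: R] (EFin \o w)).

Definition tail (X : R) := \int[m]_(t in `]X, +oo[) w t.

(** [avg] is the smoothed density at [x]; [Avg] is the smoothed tail from [X], with the kernel
    integrated beforehand. *)
Definition avg (s x : R) := normal_peak s * smooth m w s x.

Definition Avg (s X : R) := \int[m]_t (w t * Psi s X t).

Lemma tailE X : tail X = \int[m]_t (w t * \1_(`]X, +oo[) t).
Proof.
rewrite /tail Rintegral_mkcond; apply: eq_Rintegral => t _.
by rewrite patchE indicE; case: ifPn => _; rewrite ?mulr1 ?mulr0.
Qed.

Let mw : measurable_fun [set: measurableTypeR R] w.
Proof. by apply/measurable_EFinP; exact: measurable_int intw. Qed.

Lemma integrable_weighted (F : R -> R) : measurable_fun [set: measurableTypeR R] F ->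
  (forall t, 0 <= F t <= 1) -> m.-integrable [set: R] (EFin \o (fun t => w t * F t)).
Proof.
move=> mF F01; apply: le_integrable intw => //.
  by apply/measurable_EFinP; apply: measurable_funM.
move=> t _ /=; have /andP[F0 F1] := F01 t.
by rewrite lee_fin normrM ler_piMr// ger0_norm.
Qed.

Lemma integrable_Psi s X : s != 0 ->
  m.-integrable [set: R] (EFin \o (fun t => w t * Psi s X t)).
Proof.
move=> s0; apply: integrable_weighted; first exact: measurable_Psi.
by move=> t; rewrite Psi_ge0 Psi_le1.
Qed.

Lemma Avg_sandwich s (eta : R) X : 0 < s < 1 -> 0 <= eta ->
  (1 - domination_factor s eta) * tail (X + eta) <= Avg s X
  <= tail (X - eta) + domination_factor s eta * Avg 1 X.
Proof.
move=> s01 eta0; have /andP[s0 _] := s01; have s00 : s != 0 by rewrite gt_eqF.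
have i1 X' : m.-integrable [set: R] (EFin \o (fun t => w t * \1_(`]X', +oo[) t)).
  apply: integrable_weighted => //.
  by move=> t; rewrite indicE; case: (_ \in _); rewrite lexx ler01.
have P1 := integrable_Psi X (@oner_neq0 R); have Ps := integrable_Psi X s00.
rewrite !tailE /Avg -!RintegralZl//; apply/andP; split.
- apply: le_Rintegral => //; first exact: (integrableZl measurableT _ (i1 _)).
  move=> t _; have /andP[h _] := Psi_sandwich X t s01 eta0.
  by rewrite mulrCA ler_wpM2l.
- have P1d := integrableZl measurableT (domination_factor s eta) P1.
  rewrite -RintegralD//; apply: le_Rintegral => //.
    exact: (integrableD measurableT (i1 _) P1d).
  move=> t _; have /andP[_ h] := Psi_sandwich X t s01 eta0.
  by rewrite mulrCA -mulrDr ler_wpM2l.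
Qed.

(** Tonelli. Through it the pointwise estimate of smoothed densities, which the contour integral
    provides, becomes one of smoothed tails, to which [Avg_sandwich] applies. *)
Lemma integral_avg s X : s != 0 ->
  mu.-integrable `[X, +oo[ (EFin \o avg s) /\
  \int[mu]_(x in `[X, +oo[) avg s x = Avg s X.
Proof.
move=> s0.
pose f (z : measurableTypeR R * measurableTypeR R) : \bar R :=
  (w z.1 * (normal_pdf z.1 s z.2 * \1_(`[X, +oo[) z.2))%:E.
have mf : measurable_fun setT f.
  apply/measurable_EFinP; apply: measurable_funM.
    exact: (measurableT_comp mw).
  apply: measurable_funM; first exact: measurable_normal_pdf2.
  by apply: measurableT_comp.
have f0 z : (0 <= f z)%E by rewrite lee_fin !mulr_ge0 ?normal_pdf_ge0.
have FE t : (\int[mu]_x f (t, x) = (w t * Psi s X t)%:E)%E.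
  rewrite PsiE -RintegralZl//; last exact: integrable_normal_pdf_indic.
  rewrite /Rintegral fineK//.
  exact: (integrable_fin_num _ (integrableZl measurableT (w t) (integrable_normal_pdf_indic s X t))).
have GE x : (\int[m]_t f (t, x) = ((EFin \o avg s) \_ `[X, +oo[) x)%E.
  have iw : m.-integrable [set: R] (EFin \o (fun t => w t * normal_fun x s t)).
    apply: integrable_weighted; first exact: measurable_normal_fun.
    move=> t; rewrite normal_fun_ge0 /normal_fun -expR0 ler_expR mulNr oppr_le0.
    by rewrite divr_ge0 ?sqr_ge0// mulrn_wge0// sqr_ge0.
  transitivity (\int[m]_t ((w t * normal_fun x s t) * (normal_peak s * \1_(`[X, +oo[) x))%:E)%E.
    apply: eq_integral => t _; rewrite /f/= normal_pdf_sym// normal_pdfE//.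
    by congr EFin; ring.
  transitivity ((avg s x * \1_(`[X, +oo[) x)%:E).
    have -> : avg s x * \1_(`[X, +oo[) x =
        \int[m]_t (w t * normal_fun x s t) * (normal_peak s * \1_(`[X, +oo[) x).
      by rewrite /avg /smooth; ring.
    rewrite -RintegralZr// /Rintegral fineK//.
    exact: (integrable_fin_num _ (integrableZr measurableT _ iw)).
  by rewrite patchE indicE; case: ifPn => _; rewrite ?mulr1 ?mulr0.
have IE : (\int[mu]_(x in `[X, +oo[) (avg s x)%:E = (Avg s X)%:E)%E.
  have := @fubini_tonelli _ _ _ _ _ m mu f mf f0.
  under eq_integral do rewrite FE.
  under [X in _ = X -> _]eq_integral do rewrite GE.
  rewrite -integral_mkcond => <-.
  by rewrite /Avg /Rintegral fineK//; exact: integrable_fin_num (integrable_Psi X s0).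
split; last by rewrite /Rintegral IE.
have avg0 x : 0 <= avg s x.
  rewrite mulr_ge0 ?normal_peak_ge0//; apply: Rintegral_ge0 => t _.
  by rewrite mulr_ge0// normal_fun_ge0.
apply/integrableP; split.
  apply/(measurable_restrictT _ _).2 => //.
  apply: (eq_measurable_fun (fun x => \int[m]_t f (t, x))%E); first by move=> x _; rewrite GE.
  exact: (measurable_fun_fubini_tonelli_G f).
by under eq_integral do rewrite /= ger0_norm ?avg0//; rewrite IE ltry.
Qed.

Lemma Avg_ge0 s X : 0 <= Avg s X.
Proof. by apply: Rintegral_ge0 => t _; rewrite mulr_ge0 ?Psi_ge0. Qed.

Lemma tail_ge0 X : 0 <= tail X.
Proof. by apply: Rintegral_ge0. Qed.

End Average.

(** * Asymptotics of gamma tails *)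

Section AvgDifference.
Variable R : realType.
Local Notation mu := (@lebesgue_measure R).

Lemma Rintegral_expR_tail (c X : R) : 0 < c ->
  \int[mu]_(x in `[X, +oo[) expR (- (c * x)) = expR (- (c * X)) / c.
Proof. by move=> c0; rewrite /Rintegral integral_expR_tail. Qed.

Lemma Avg_difference (m1 m2 : {sigma_finite_measure set (measurableTypeR R) -> \bar R})
    (w1 w2 : R -> R) (a r K c s X : R) :
  (forall t, 0 <= w1 t) -> (forall t, 0 <= w2 t) ->
  m1.-integrable [set: R] (EFin \o w1) -> m2.-integrable [set: R] (EFin \o w2) ->
  s != 0 -> 0 < c ->
  (forall x, `|a * smooth m1 w1 s x - r * smooth m2 w2 s x| <= K * expR (- (c * x))) ->
  `|a * Avg m1 w1 s X - r * Avg m2 w2 s X| <=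
    normal_peak s * K / c * expR (- (c * X)).
Proof.
move=> w10 w20 i1 i2 s0 c0 hK.
have [ia1 <-] := integral_avg w10 i1 X s0.
have [ia2 <-] := integral_avg w20 i2 X s0.
have mX : measurable (`[X, +oo[%classic : set (measurableTypeR R)) by [].
have ia1a := integrableZl mX a ia1.
have ia2r := integrableZl mX r ia2.
have iK := integrableZl mX (normal_peak s * K) (integrable_expR_tail X c0).
rewrite -!RintegralZl// -RintegralB//.
have iab := integrableB mX ia1a ia2r.
apply: (le_trans (le_normr_Rintegral _ iab)) => //.
rewrite mulrAC -mulrA -Rintegral_expR_tail// -RintegralZl//; last exact: integrable_expR_tail.
apply: le_Rintegral => //; first exact: (integrable_abse iab).
move=> x _; rewrite /avg mulrCA (mulrCA r) -mulrBr normrM.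
by rewrite ger0_norm ?normal_peak_ge0// -mulrA ler_wpM2l ?normal_peak_ge0.
Qed.

End AvgDifference.

(** * Bounds and limits for gamma tails *)

Section GammaTail.
Variable R : realType.
Local Notation mu := (@lebesgue_measure R).

Lemma cvg_divy (c : R) (F : set_system R) (FF : Filter F) (f : R -> R) :
  f x @[x --> F] --> +oo -> c / f x @[x --> F] --> (0 : R).
Proof.
move=> fy; apply/cvgr0Pnorm_le => e e0; near=> x.
have f0 : 0 < f x by near: x; move/cvgryPgt : fy; apply.
rewrite normrM normfV (gtr0_norm f0) ler_pdivrMr// mulrC -ler_pdivrMr//.
by near: x; move/cvgryPge : fy; apply.
Unshelve. all: by end_near. Qed.

Variables (j : nat) (a : R).
Hypothesis a0 : 0 < a.

Definition gdens (x : R) := x ^+ j * expR (- (a * x)).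

Lemma gdens_gt0 x : 0 < x -> 0 < gdens x.
Proof. by move=> x0; rewrite mulr_gt0 ?exprn_gt0 ?expR_gt0. Qed.

Lemma tail_gweight X : tail mu (gweight j a) X = \int[mu]_(t in `[X, +oo[) gweight j a t.
Proof.
rewrite /tail Rintegral_itv_obnd_cbnd//.
by apply: integrableS (integrable_gweight j a0).
Qed.

Lemma tail_gweight_ge X : 0 < X -> gdens X / a <= tail mu (gweight j a) X.
Proof.
move=> X0; rewrite tail_gweight /gdens -mulrA -Rintegral_expR_tail//.
rewrite -RintegralZl//; last exact: integrable_expR_tail.
have mX : measurable (`[X, +oo[%classic : set (measurableTypeR R)) by [].
apply: le_Rintegral => //.
- exact: (integrableZl mX (X ^+ j) (integrable_expR_tail X a0)).
- by apply: integrableS (integrable_gweight j a0).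
- move=> t; rewrite /= in_itv/= andbT => Xt.
  have t0 : 0 <= t by rewrite (le_trans _ Xt)// ltW.
  by rewrite gweightE// ler_wpM2r ?expR_ge0// lerXn2r// nnegrE ltW.
Qed.

(** The exponential touching the weight at [X] has rate [a - j / X], which tends to [a]; with
    [tail_gweight_ge] this pins down the tail asymptotically. *)
Lemma tail_gweight_le X : 0 < X -> j%:R / X < a ->
  tail mu (gweight j a) X <= gdens X / (a - j%:R / X).
Proof.
move=> X0 jX; rewrite tail_gweight; pose g := a - j%:R / X.
have g0 : 0 < g by rewrite subr_gt0.
have mX : measurable (`[X, +oo[%classic : set (measurableTypeR R)) by [].
have iE := integrableZl mX (gdens X * expR (g * X)) (integrable_expR_tail X g0).
apply: le_trans (_ : \int[mu]_(t in `[X, +oo[) (gdens X * expR (g * X) * expR (- (g * t))) <= _).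
  apply: le_Rintegral => //.
    by apply: integrableS (integrable_gweight j a0).
  move=> t _; rewrite (le_trans (gweight_le _ _ _ X0))// -(mulrA (gdens X)) ler_wpM2l//.
    by rewrite ltW// gdens_gt0.
  rewrite -expRD -/g le_eqVlt; apply/orP; left; apply/eqP; congr expR; ring.
rewrite RintegralZl//; last exact: integrable_expR_tail.
have e1 : expR (g * X) * expR (- (g * X)) = 1 by rewrite -expRD subrr expR0.
by rewrite Rintegral_expR_tail// -(mulrA (gdens X)) (mulrA (expR (g * X))) e1 mul1r.
Qed.

(** Against a standard Gaussian centred at [x], the touching exponential of rate [g = a - j / x]
    gives, by completing the square, the factor [exp(g^2 / 2)] and a Gaussian centred at [x - g];
    finally [g <= a]. *)
Lemma avg_gweight_le x : 0 < x -> j%:R / x <= a ->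
  avg mu (gweight j a) 1 x <= expR (a ^+ 2 / 2) * gdens x.
Proof.
move=> x0 jx; pose g := a - j%:R / x.
have g0 : 0 <= g by rewrite subr_ge0.
have ga : g <= a by rewrite gerBl divr_ge0// ltW.
have inf : mu.-integrable [set: R] (EFin \o (fun t => gweight j a t * normal_fun x 1 t)).
  apply: (@integrable_weighted R mu (gweight j a)) => //.
  - exact: integrable_gweight.
  - exact: measurable_normal_fun.
  - move=> t; rewrite normal_fun_ge0 /normal_fun -expR0 ler_expR mulNr oppr_le0.
    by rewrite divr_ge0 ?sqr_ge0// mulrn_wge0// sqr_ge0.
rewrite /avg /smooth -RintegralZl//.
apply: le_trans (_ : \int[mu]_t (expR (a ^+ 2 / 2) * gdens x * normal_pdf (x - g) 1 t) <= _); last first.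
  rewrite RintegralZl//; last exact: integrable_normal_pdf.
  by rewrite Rintegral_normal_pdf mulr1.
apply: le_Rintegral => //.
- exact: (integrableZl measurableT _ inf).
- exact: (integrableZl measurableT (expR (a ^+ 2 / 2) * gdens x) (integrable_normal_pdf (x - g) 1)).
move=> t _; rewrite normal_pdf_expE// (mulrC _ (normal_peak 1 * _)) -mulrA.
rewrite ler_wpM2l ?normal_peak_ge0//.
apply: (@le_trans _ _ (gdens x * expR (- (g * (t - x))) * normal_fun x 1 t)).
  by rewrite ler_wpM2r ?normal_fun_ge0// gweight_le.
rewrite (mulrC (expR (a ^+ 2 / 2))) mulrCA -mulrA ler_wpM2l//; first by rewrite ltW// gdens_gt0.
rewrite /normal_fun -!expRD ler_expR expr1n.
have : g ^+ 2 <= a ^+ 2 by rewrite lerXn2r// nnegrE// ltW.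
by move=> ga2; lra.
Qed.

(** Smoothing with [s = 1] costs only a constant factor; this makes the error term of [Avg_sandwich]
    a small multiple of the tail. *)
Lemma Avg_gweight_le X : 0 < X -> j%:R / X <= a ->
  Avg mu (gweight j a) 1 X <= expR (a ^+ 2 / 2) * tail mu (gweight j a) X.
Proof.
move=> X0 jX.
have [ia <-] := integral_avg (gweight_ge0 j a) (integrable_gweight j a0) X (@oner_neq0 R).
have mX : measurable (`[X, +oo[%classic : set (measurableTypeR R)) by [].
have iX : mu.-integrable `[X, +oo[ (EFin \o gweight j a).
  by apply: integrableS (integrable_gweight j a0).
rewrite tail_gweight -RintegralZl//; apply: le_Rintegral => //.
  exact: (integrableZl mX _ iX).
move=> x; rewrite /= in_itv/= andbT => Xx; have x0 := lt_le_trans X0 Xx.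
have jx : j%:R / x <= a by rewrite (le_trans _ jX)// ler_wpM2l// lef_pV2.
by rewrite (gweightE _ _ (ltW x0)); exact: avg_gweight_le.
Qed.

Lemma cvg_gdens_shift (d : R) : gdens (x + d) / gdens x @[x --> +oo] --> expR (- (a * d)).
Proof.
have cvg1 : (1 + d / x) @[x --> +oo] --> (1 : R).
  rewrite -[X in _ --> X]addr0; apply: cvgD; first exact: cvg_cst.
  by apply: cvg_divy; exact: cvg_id.
have : (1 + d / x) ^+ j * expR (- (a * d)) @[x --> +oo] --> (1 ^+ j * expR (- (a * d)) : R).
  apply: cvgM; last exact: cvg_cst.
  by apply: (cvg_comp _ (fun y => y ^+ j) cvg1); exact: exprn_continuous.
rewrite expr1n mul1r; apply: cvg_trans; apply: near_eq_cvg; near=> x.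
have x0 : 0 < x by near: x; exact: nbhs_pinfty_gt.
rewrite /gdens (_ : 1 + d / x = (x + d) / x); last by field; rewrite gt_eqF.
rewrite mulrDr opprD expRD expr_div_n.
by field; rewrite !gt_eqF ?expR_gt0 ?exprn_gt0.
Unshelve. all: by end_near. Qed.

Lemma cvg_tail_gweight_shift (d : R) :
  tail mu (gweight j a) (x + d) / gdens x @[x --> +oo] --> expR (- (a * d)) / a.
Proof.
have c1 := @cvg_gdens_shift d.
have cd : x + d @[x --> +oo] --> +oo.
  by apply/cvgryPge => A; near=> x; rewrite -lerBlDr; near: x;
    apply: nbhs_pinfty_ge; exact: num_real.
have c0 : j%:R / (x + d) @[x --> +oo] --> (0 : R).
  exact: cvg_divy.
apply: (@squeeze_cvgr _ _ _ _ (fun x => gdens (x + d) / gdens x / a)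
  (fun x => gdens (x + d) / gdens x / (a - j%:R / (x + d)))).
- near=> x.
  have x0 : 0 < x by near: x; exact: nbhs_pinfty_gt.
  have xd0 : 0 < x + d by near: x; move/cvgryPgt : cd; apply.
  have jx : j%:R / (x + d) < a.
    by near: x; move/cvgrPdist_lt: c0 => /(_ _ a0); apply: filterS => x; rewrite sub0r normrN => /ltr_normlW.
  have g0 := gdens_gt0 x0.
  apply/andP; split.
    by rewrite mulrAC ler_wpM2r ?invr_ge0 ?(ltW g0)// tail_gweight_ge.
  by rewrite mulrAC ler_wpM2r ?invr_ge0 ?(ltW g0)// tail_gweight_le.
- by apply: cvgM; [exact: c1|exact: cvg_cst].
- apply: cvgM; first exact: c1.
  apply: cvgV; first by rewrite gt_eqF.
  rewrite -[X in _ --> X]subr0; apply: cvgB; [exact: cvg_cst|exact: c0].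
Unshelve. all: by end_near. Qed.

Lemma cvg_expR_gdens (c d : R) : a < c ->
  expR (- (c * (x + d))) / gdens x @[x --> +oo] --> (0 : R).
Proof.
move=> ac; have ca : 0 < c - a by rewrite subr_gt0.
apply: (@squeeze_cvgr _ _ _ _ (fun=> 0) (fun x => expR (- (c * d)) * expR (- ((c - a) * x)))).
- near=> x.
  have x1 : 1 <= x by near: x; exact: nbhs_pinfty_ge.
  have x0 : 0 < x by exact: lt_le_trans x1.
  rewrite divr_ge0 ?expR_ge0 ?(ltW (gdens_gt0 x0))//= ler_pdivrMr ?gdens_gt0//.
  have -> : expR (- (c * (x + d))) =
      expR (- (c * d)) * expR (- ((c - a) * x)) * (1 * expR (- (a * x))).
    by rewrite mul1r -!expRD; congr expR; ring.
  rewrite ler_wpM2l ?mulr_ge0 ?expR_ge0// ler_wpM2r ?expR_ge0//.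
  exact: exprn_ege1.
- exact: cvg_cst.
- rewrite -(mulr0 (expR (- (c * d)))); apply: cvgM; first exact: cvg_cst.
  apply: (@cvg_comp _ _ _ (fun x => (c - a) * x) (fun x => expR (- x)) _ (pinfty_nbhs R)).
    by apply: gt0_cvgMry.
  exact: cvgr_expR.
Unshelve. all: by end_near. Qed.

End GammaTail.

(** * The Tauberian argument *)

Section Arithmetic.
Variable R : realType.
Implicit Types (A d e r K E T P : R).

(** [A] and [A1] stand for the smoothed tails of the measure for deviations [s] and [1], [Ap] and
    [Ap1] for those of the gamma weight, [T] for the tail to be bounded, [E] for the exponential.
    The error [d A1] is controlled through [A1 <= r P1 + K1 E]. *)
Lemma lower_arith A A1 Ap Ap1 d eta r T P2 P1 E K K1 :
  0 <= d -> d <= eta -> 0 <= A1 ->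
  A <= T + d * A1 -> A1 - r * Ap1 <= K1 * E -> r * Ap1 <= r * P1 ->
  - (K * E) <= A - r * Ap -> r * P2 <= r * Ap ->
  r * (P2 - eta * P1) - (K + eta * K1) * E <= T.
Proof.
move=> d0 de A10 h1 h2 h3 h4 h5.
have h6 : A1 <= r * P1 + K1 * E by lra.
have h7 : d * A1 <= eta * (r * P1 + K1 * E) by exact: ler_pM.
lra.
Qed.

Lemma squeeze_arith L U T l u v e :
  `|v - u| <= e / 2 -> `|v - l| <= e / 2 -> `|u - U| <= e / 2 -> `|l - L| <= e / 2 ->
  L <= T -> T <= U -> `|v - T| <= e.
Proof.
rewrite !ler_norml => /andP[? ?] /andP[? ?] /andP[? ?] /andP[? ?] ? ?.
by apply/andP; split; lra.
Qed.

Lemma half_le_onem d : d <= 2^-1 -> 2^-1 <= 1 - d.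
Proof. by move=> ?; lra. Qed.

End Arithmetic.

Section Tauberian.
Variable R : realType.
Local Notation mu := (@lebesgue_measure R).
Variables (j : nat) (a c : R).
Hypotheses (a0 : 0 < a) (ac : a < c).
Local Notation p := (gweight j a).
Local Notation ptail := (tail mu p).
Local Notation q := (gdens j a).

Lemma le_tail_gweight (x y : R) : x <= y -> ptail y <= ptail x.
Proof.
move=> xy; have ip := integrable_gweight j a0.
have i1 X' : mu.-integrable [set: R] (EFin \o (fun t => p t * \1_(`]X', +oo[) t)).
  apply: (@integrable_weighted R mu p) => //.
  by move=> t; rewrite indicE; case: (_ \in _); rewrite lexx ler01.
rewrite !tailE; apply: le_Rintegral => // t _.
rewrite ler_wpM2l ?gweight_ge0// !indicE ler_nat.
have [|//] := boolP (t \in `]y, +oo[%classic).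
rewrite inE/= in_itv/= andbT => yt.
by rewrite mem_set//= in_itv/= (le_lt_trans xy).
Qed.

(** For [rho > 0] the left side is at least [rho / 2] times the gamma tail at [X + 1], of order
    [X^j exp(- a X)], which no multiple of [exp(- c X)] dominates. This yields both the sign of [r]
    and the reality of [b]. *)
Lemma Avg_gweight_dominates (rho : R) :
  (forall s, 0 < s < 1 -> exists K : R, forall X,
    rho * Avg mu p s X <= K * expR (- (c * X))) -> rho <= 0.
Proof.
move=> hK; rewrite leNgt; apply/negP => rho0.
have half0 : 0 < 2^-1 :> R by rewrite invr_gt0.
have [s s01 /andP[d0 dh]] := domination_factor_small (@ltr01 R) half0.
have [K {}hK] := hK s s01.
have c1 := @cvg_tail_gweight_shift R j a a0 1.
have c2 := @cvg_expR_gdens R j a c 0 ac.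
have c3 : rho / 2 * (ptail (x + 1) / q x) @[x --> +oo] --> rho / 2 * (expR (- (a * 1)) / a).
  by apply: cvgM; [exact: cvg_cst|exact: c1].
have c4 : K * (expR (- (c * (x + 0))) / q x) @[x --> +oo] --> K * 0.
  by apply: cvgM; [exact: cvg_cst|exact: c2].
have : rho / 2 * (expR (- (a * 1)) / a) <= K * 0.
  apply: (ler_cvg_to c3 c4); near=> x.
  have x0 : 0 < x by near: x; exact: nbhs_pinfty_gt.
  rewrite !mulrA ler_wpM2r ?invr_ge0 ?(ltW (gdens_gt0 _ _ x0))// addr0.
  apply: le_trans (hK x).
  have /andP[+ _] := Avg_sandwich (gweight_ge0 j a) (integrable_gweight j a0) x s01 (@ler01 R).
  move=> h1; rewrite -mulrA ler_wpM2l ?(ltW rho0)//; apply: le_trans h1.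
  rewrite ler_wpM2r//; first by apply: tail_ge0; exact: gweight_ge0.
  exact: half_le_onem.
rewrite mulr0 leNgt => /negP; apply.
by rewrite mulr_gt0 ?divr_gt0 ?expR_gt0.
Unshelve. all: by end_near. Qed.

Variables (m : {sigma_finite_measure set (measurableTypeR R) -> \bar R}) (w : R -> R).
Hypotheses (w0 : forall t, 0 <= w t) (intw : m.-integrable [set: R] (EFin \o w)).
Variable (r : R).
Hypothesis close : forall s, 0 < s -> exists K : R, forall X,
  `|Avg m w s X - r * Avg mu p s X| <= K * expR (- (c * X)).

(** Smoothed tails of the measure are nonnegative, so [- r] times that of the gamma weight is at
    most the exponential error. The sign lets inequalities between gamma tails be multiplied by
    [r]. *)
Lemma tauberian_ge0 : 0 <= r.
Proof.
rewrite -oppr_le0; apply: Avg_gweight_dominates => s /andP[s0 _].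
have [K hK] := close s0; exists K => X.
have := hK X; rewrite ler_norml => /andP[_ h].
by have := Avg_ge0 m w0 s X; rewrite mulNr; lra.
Qed.

Let B := expR (a ^+ 2 / 2).

(** Both sandwiches are taken at [x - eta]: the one for the measure reaches [x], the one for the
    gamma weight [x - 2 eta]. As [eta] also bounds the domination factor, one parameter governs both
    the shift and the error. *)
Lemma tail_upper (eta s K x : R) : 0 <= eta -> 0 < s < 1 ->
  0 <= domination_factor s eta <= eta ->
  (forall X, `|Avg m w s X - r * Avg mu p s X| <= K * expR (- (c * X))) ->
  0 < x - eta -> j%:R / (x - eta) <= a ->
  (1 - eta) * tail m w x <=
    r * ((1 + eta * B) * ptail (x - 2 * eta)) + K * expR (- (c * (x - eta))).
Proof.
move=> eta0 s01 /andP[d0 de] hK x0 jx.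
have r0 := tauberian_ge0.
have /andP[h1 _] := Avg_sandwich w0 intw (x - eta) s01 eta0.
have /andP[_ h2] := Avg_sandwich (gweight_ge0 j a) (integrable_gweight j a0) (x - eta) s01 eta0.
have := hK (x - eta); rewrite ler_norml => /andP[_ h3].
have h4 := Avg_gweight_le a0 x0 jx.
have h5 : ptail (x - eta) <= ptail (x - 2 * eta) by apply: le_tail_gweight; rewrite lerB// ler_peMl// ler1n.
rewrite subrK in h1; rewrite (_ : x - eta - eta = x - 2 * eta) in h2; last by ring.
have t0 : 0 <= tail m w x by apply: tail_ge0.
have h6 : (1 - eta) * tail m w x <= (1 - domination_factor s eta) * tail m w x.
  by rewrite ler_wpM2r// lerB.
have h7 : domination_factor s eta * Avg mu p 1 (x - eta) <= eta * (B * ptail (x - 2 * eta)).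
  apply: ler_pM => //; first by apply: Avg_ge0; exact: gweight_ge0.
  by rewrite (le_trans h4)// ler_wpM2l ?expR_ge0.
have h8 : r * Avg mu p s (x - eta) <= r * ((1 + eta * B) * ptail (x - 2 * eta)).
  by rewrite ler_wpM2l// mulrDl mul1r -mulrA (le_trans h2)// lerD2l.
apply: (le_trans h6); apply: (le_trans h1).
move: h3; rewrite lerBlDr => /le_trans; apply.
by rewrite [leRHS]addrC lerD2l.
Qed.

(** Here the error term is the smoothed tail of the measure itself for deviation [1]; the comparison
    at [s = 1] bounds it and brings in [K1] and the gamma tail at [x + eta]. *)
Lemma tail_lower (eta s K K1 x : R) : 0 <= eta -> 0 < s < 1 ->
  0 <= domination_factor s eta <= eta ->
  (forall X, `|Avg m w s X - r * Avg mu p s X| <= K * expR (- (c * X))) ->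
  (forall X, `|Avg m w 1 X - r * Avg mu p 1 X| <= K1 * expR (- (c * X))) ->
  0 < x + eta -> j%:R / (x + eta) <= a ->
  r * ((1 - eta) * ptail (x + 2 * eta) - eta * (B * ptail (x + eta)))
    - (K + eta * K1) * expR (- (c * (x + eta))) <= tail m w x.
Proof.
move=> eta0 s01 /andP[d0 de] hK hK1 x0 jx.
have r0 := tauberian_ge0.
have /andP[_ h1] := Avg_sandwich w0 intw (x + eta) s01 eta0.
have /andP[h2 _] := Avg_sandwich (gweight_ge0 j a) (integrable_gweight j a0) (x + eta) s01 eta0.
have := hK (x + eta); rewrite ler_norml => /andP[h3 _].
have := hK1 (x + eta); rewrite ler_norml => /andP[_ h3'].
have h4 := Avg_gweight_le a0 x0 jx.
rewrite addrK in h1; rewrite (_ : x + eta + eta = x + 2 * eta) in h2; last by ring.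
have h6 : (1 - eta) * ptail (x + 2 * eta) <= Avg mu p s (x + eta).
  apply: le_trans h2; rewrite ler_wpM2r//; last by rewrite lerB.
  by apply: tail_ge0; exact: gweight_ge0.
have A10 : 0 <= Avg m w 1 (x + eta) by exact: Avg_ge0.
apply: (lower_arith d0 de A10 h1 h3' _ h3).
  by rewrite ler_wpM2l.
by rewrite ler_wpM2l.
Qed.

(** The choices are made in the order [eta], [s], then [K] and [K1], then [x]: once [s] is fixed,
    the exponential terms vanish relative to [q x] whatever the size of these constants. *)
Theorem tauberian : tail m w x / q x @[x --> +oo] --> r / a.
Proof.
have r0 := tauberian_ge0.
apply/cvgrPdist_le => e e0; have e20 : 0 < e / 2 by rewrite divr_gt0.
(* [u] and [l] are the limits in [x] of the bounds [U] and [L] below; both tend to [r / a] as [eta]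
   tends to [0]. *)
pose u (eta : R) := (r * ((1 + eta * B) * (expR (- (a * (- 2 * eta))) / a))) / (1 - eta).
pose l (eta : R) := r * ((1 - eta) * (expR (- (a * (2 * eta))) / a)
   - eta * (B * (expR (- (a * (1 * eta))) / a))).
have cid0 : (fun x : R => x) @ 0^'+ --> (0 : R) by apply: cvg_at_right_filter; exact: cvg_id.
have cE (d : R) : expR (- (a * (d * eta))) @[eta --> 0^'+] --> (1 : R).
  rewrite -expR0; apply: (@cvg_comp _ _ _ (fun eta => - (a * (d * eta))) expR); last exact: continuous_expR.
  have : - (a * (d * eta)) @[eta --> 0^'+] --> - (a * (d * 0)).
    by apply: cvgN; apply: cvgM; [exact: cvg_cst|apply: cvgM; [exact: cvg_cst|exact: cid0]].
  by rewrite !mulr0 oppr0.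
have cu : u eta @[eta --> 0^'+] --> r / a.
  rewrite (_ : r / a = (r * ((1 + 0 * B) * (1 / a))) / (1 - 0)); last by field; rewrite gt_eqF.
  apply: cvgM; last first.
    apply: cvgV; first by rewrite subr0.
    by apply: cvgB; [exact: cvg_cst|exact: cid0].
  apply: cvgM; first exact: cvg_cst.
  apply: cvgM; last first.
    apply: cvgM; last exact: cvg_cst.
    exact: cE.
  apply: cvgD; first exact: cvg_cst.
  by apply: cvgM; [exact: cid0|exact: cvg_cst].
have cl : l eta @[eta --> 0^'+] --> r / a.
  rewrite (_ : r / a = r * ((1 - 0) * (1 / a) - 0 * (B * (1 / a)))); last by field; rewrite gt_eqF.
  apply: cvgM; first exact: cvg_cst.
  apply: cvgB; apply: cvgM.
  - by apply: cvgB; [exact: cvg_cst|exact: cid0].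
  - by apply: cvgM; [exact: cE|exact: cvg_cst].
  - exact: cid0.
  - apply: cvgM; first exact: cvg_cst.
    apply: cvgM; last exact: cvg_cst.
    exact: cE.
have [eta [[eta0 eta1] [hu hl]]] : exists eta : R, (0 < eta /\ eta < 1) /\
    (`|r / a - u eta| <= e / 2 /\ `|r / a - l eta| <= e / 2).
  apply: (@filter_ex _ (0^'+ : set_system R)); near=> eta; split; split.
  - by near: eta; exact: nbhs_right_gt.
  - by near: eta; exact: nbhs_right_lt.
  - by near: eta; move/cvgrPdist_le: cu; apply.
  - by near: eta; move/cvgrPdist_le: cl; apply.
have [s s01 hd] := domination_factor_small eta0 eta0.
have /andP[s0 _] := s01.
have [K hK] := close s0; have [K1 hK1] := close (@ltr01 R).
pose U x := (r * ((1 + eta * B) * (ptail (x + - 2 * eta) / q x))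
  + K * (expR (- (c * (x + - eta))) / q x)) / (1 - eta).
pose L x := r * ((1 - eta) * (ptail (x + 2 * eta) / q x)
   - eta * (B * (ptail (x + 1 * eta) / q x))) - (K + eta * K1) * (expR (- (c * (x + eta))) / q x).
have eta10 : 1 - eta != 0 by rewrite gt_eqF// subr_gt0.
have cU : U x @[x --> +oo] --> u eta.
  rewrite /u -[X in X / _]addr0 -[X in _ + X](mulr0 K).
  apply: cvgM; last exact: cvg_cst.
  apply: cvgD; apply: cvgM; try exact: cvg_cst.
  - apply: cvgM; first exact: cvg_cst.
    exact: cvg_tail_gweight_shift.
  - exact: cvg_expR_gdens.
have cL : L x @[x --> +oo] --> l eta.
  rewrite /l -[X in _ --> X]subr0 -[X in _ - X](mulr0 (K + eta * K1)).
  apply: cvgB; apply: cvgM; try exact: cvg_cst; last exact: cvg_expR_gdens.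
  apply: cvgB; apply: cvgM; try exact: cvg_cst.
  - exact: cvg_tail_gweight_shift.
  - apply: cvgM; first exact: cvg_cst.
    exact: cvg_tail_gweight_shift.
near=> x.
have x0 : 0 < x by near: x; exact: nbhs_pinfty_gt.
have q0 : 0 < q x by exact: gdens_gt0.
have xe : 0 < x - eta by rewrite subr_gt0; near: x; apply: nbhs_pinfty_gt; exact: num_real.
have xe' : 0 < x + eta by rewrite addr_gt0.
have jx : j%:R / (x - eta) <= a.
  rewrite ler_pdivrMr// mulrC -ler_pdivrMr// lerBrDr.
  by near: x; apply: nbhs_pinfty_ge; exact: num_real.
have jx' : j%:R / (x + eta) <= a.
  rewrite (le_trans _ jx)// ler_wpM2l// lef_pV2//.
  by rewrite lerD2l ge0_cp// ltW.
have hU : `|u eta - U x| <= e / 2 by near: x; move/cvgrPdist_le: cU; apply.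
have hL : `|l eta - L x| <= e / 2 by near: x; move/cvgrPdist_le: cL; apply.
have upper : tail m w x / q x <= U x.
  rewrite ler_pdivlMr ?subr_gt0// mulrAC ler_pdivrMr// mulrC.
  apply: (le_trans (tail_upper (ltW eta0) s01 hd hK xe jx)).
  rewrite mulNr le_eqVlt; apply/orP; left; apply/eqP; field; rewrite gt_eqF//.
have lower : L x <= tail m w x / q x.
  rewrite ler_pdivlMr//.
  apply: le_trans (tail_lower (ltW eta0) s01 hd hK hK1 xe' jx').
  by rewrite le_eqVlt; apply/orP; left; apply/eqP; rewrite /L mul1r; field; rewrite gt_eqF.
exact: squeeze_arith hu hl hU hL lower upper.
Unshelve. all: by end_near. Qed.

End Tauberian.

(** * Reality of the coefficient and the limit *)

Lemma cvg_complex_of_real (R : realType) (f : R -> R) (l : R) :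
  f x @[x --> +oo] --> l ->
  ((f x)%:C : R[i]^o) @[x --> +oo] --> (l%:C : R[i]^o).
Proof.
move=> fl; apply/cvgrPdist_le => -[e e']; rewrite ltcE/= => /andP[/eqP -> e0].
near=> x; rewrite -rmorphB/= normc_real lecR.
by near: x; move/cvgrPdist_le: fl; apply.
Unshelve. all: by end_near. Qed.

(* [h] is the extension of [g - g_0] and [D] the set where it is defined: the
   half plane [Re z < beta] and possibly some points of the line
   [Re z = beta]. *)
Theorem lemma6p2 (R : realType)
  (nu : {finite_measure set (measurableTypeR R) -> \bar R})
  (nu_supp : nu `]-oo, 0%R[%classic = 0%E)
  (k : nat) (b : R[i]) (alpha beta : R) (D : set R[i]) (h : R[i] -> R[i])
  (k_gt0 : (0 < k)%N) (alpha_gt0 : 0 < alpha) (alpha_lt_beta : alpha < beta)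
  (subD : [set z | complex.Re z < beta] `<=` D)
  (Dsub : D `<=` [set z | complex.Re z <= beta])
  (h_analytic : analytic_on [set z | complex.Re z < beta] h)
  (h_extends : forall z : R[i], complex.Re z <= 0 ->
     h z = mgf nu z - b / (alpha%:C - z) ^+ k)
  (h_bounded : exists eps0 : R, 0 < eps0 /\
     exists M : R, forall z : R[i], D z -> 0 <= complex.Re z <= beta ->
       eps0%:C < `|z - alpha%:C| -> `|h z| <= M%:C) :
  ((fine (nu `]x, +oo[%classic) / (x ^+ k.-1 * expR (- alpha * x)))%:C
     : R[i]^o) @[x --> +oo%R]
    --> (b * (alpha%:C)^-1 / (Gamma k%:R)%:C : R[i]^o).
Proof.
pose w : R -> R := \1_(`[0%R, +oo[).
pose p := gweight k.-1 alpha.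
pose b' := b / ((k.-1)`!%:R)%:C.
(* Any point strictly between [alpha] and [beta] would do. *)
pose c := (alpha + beta) / 2.
have ac : alpha < c by rewrite /c; lra.
have cb : c < beta by rewrite /c; lra.
have c0 : 0 < c by exact: lt_trans ac.
have w0 t : 0 <= w t by rewrite /w indicE.
have p0 t : 0 <= p t by exact: gweight_ge0.
have intw : nu.-integrable [set: R] (EFin \o w) by exact: integrable_indic.
have intp := integrable_gweight k.-1 alpha_gt0.
have c0b : 0 <= c < beta by rewrite ltW.
have close (th : R[i]) s : `|th| <= 1 -> 0 < s -> exists K : R, forall X,
    `|complex.Re th * Avg nu w s X - complex.Re (th * b') * Avg lebesgue_measure p s X|
    <= K * expR (- (c * X)).
  move=> th1 s0; have s00 : s != 0 by rewrite gt_eqF.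
  have [K hK] := smooth_difference k_gt0 alpha_gt0 subD h_analytic h_extends h_bounded s00 c0b.
  exists (normal_peak s * K / c) => X.
  by apply: Avg_difference => // x; exact: hK.
have Imb0 : complex.Im b' = 0.
  (* With [th = i] the measure drops out, since [Re th = 0], and [Re (i b') = - Im b']: the smoothed
     gamma tail times [|Im b'|] is [O(exp(- c X))]. The disjunction treats both signs at once. *)
  have bound (rho : R) : rho = complex.Im b' \/ rho = - complex.Im b' -> rho <= 0.
    move=> rhoE; apply: (@Avg_gweight_dominates R k.-1 alpha c alpha_gt0 ac) => s /andP[s0 _].
    have i1 : `|0 +i* 1 : R[i]| <= 1.
      by rewrite normc_def/= expr0n expr1n add0r sqrtr1.
    have [K hK] := close _ s i1 s0; exists K => X.
    apply: le_trans (hK X); rewrite mul0r sub0r normrN ReM/= mul0r mul1r sub0r.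
    case: rhoE => ->; last exact: ler_norm.
    by rewrite mulNr normrN ler_norm.
  apply/eqP; rewrite eq_le bound/=; last by left.
  by rewrite -oppr_le0 bound//; right.
pose r := complex.Re b'.
have b'E : b' = r%:C by apply/eqP; rewrite eq_complex/= Imb0 !eqxx.
have lim : tail nu w x / gdens k.-1 alpha x @[x --> +oo] --> r / alpha.
  apply: (@tauberian R k.-1 alpha c alpha_gt0 ac nu w w0 intw r) => s s0.
  have n1 : `|1 : R[i]| <= 1 by rewrite normr1.
  have [K hK] := close 1 s n1 s0; exists K => X.
  by have := hK X; rewrite mul1r /= mul1r.
have -> : b * (alpha%:C)^-1 / (Gamma k%:R)%:C = (r / alpha)%:C.
  by rewrite Gamma_nat// mulrAC -/b' b'E -fmorphV -rmorphM.
apply: cvg_complex_of_real; apply: cvg_trans lim; apply: near_eq_cvg; near=> x.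
have x0 : 0 < x by near: x; exact: nbhs_pinfty_gt.
rewrite /gdens mulNr; congr (_ / _).
(* For [x > 0] the weight [w] is [1] on []x, +oo[], so [tail] is the measure of that half line. *)
rewrite /tail (@eq_Rintegral _ _ _ _ _ (cst 1)); last first.
  move=> t; rewrite inE/= in_itv/= andbT => xt.
  by rewrite /w indicE mem_set//= in_itv/= ltW// (lt_trans x0).
by rewrite Rintegral_cst// mul1r.
Unshelve. all: by end_near. Qed.
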